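(* Let $u$ and $v$ be unitary operators acting on the Hilbert space $\mathcal H$ such that $-1\notin\operatorname{spec}(u)$ and $-1\notin\operatorname{spec}(v)$, and such that $\theta_+(u)+\theta_+(v)<\pi$ and $\theta_-(u)+\theta_-(v)>-\pi$. Then $-1\notin\operatorname{spec}(uv)$, $$\theta_+(u)+\theta_+(v)\geq\theta_+(uv)\quad\text{and}\quad\theta_-(u)+\theta_-(v)\leq\theta_-(uv).$$ If $\theta_+(uv)=\theta_+(u)+\theta_+(v)<\pi$, then $$\mathcal H_+(u)\cap\mathcal H_+(v)=\mathcal H_+(uv),$$ and if $\theta_-(uv)=\theta_-(u)+\theta_-(v)>-\pi$, then $$\mathcal H_-(u)\cap\mathcal H_-(v)=\mathcal H_-(uv).$$
   Context: $\mathcal H$ is a nonzero separable complex Hilbert space (possibly infinite dimensional), and $\operatorname{spec}$ denotes the spectrum of a bounded operator. For a unitary operator $u$ on $\mathcal H$ with $-1\notin\operatorname{spec}(u)$, let $\log(u)$ be defined by continuous functional calculus with the principal branch of the logarithm, so that $-i\log(u)$ is self-adjoint with spectrum in $(-\pi,\pi)$, and define $$\theta_+(u)=\max\operatorname{spec}(-i\log(u)),\qquad \theta_-(u)=\min\operatorname{spec}(-i\log(u)),$$ $$\mathcal H_+(u)=\{\xi\in\mathcal H: u\xi=e^{i\theta_+(u)}\xi\},\qquad \mathcal H_-(u)=\{\xi\in\mathcal H: u\xi=e^{i\theta_-(u)}\xi\}.$$ These eigenspaces may be $\{0\}$. *)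

(* Defs.v *)
From HB Require Import structures.
From mathcomp Require Import all_boot all_order all_algebra.
From mathcomp Require Import sesquilinear complex.
From mathcomp Require Import all_classical all_reals all_analysis.
Set Implicit Arguments.
Unset Strict Implicit.
Unset Printing Implicit Defensive.
Import Order.TTheory GRing.Theory Num.Theory.
Import numFieldNormedType.Exports.
Local Open Scope classical_set_scope.
Local Open Scope ring_scope.
Local Open Scope complex_scope.

(* A complex Hilbert space is a complete normed space over R[i] whose norm comes
   from an inner product (linear in its first argument). *)
HB.mixin Record CompleteNormedModule_isHilbert (R : realType) H
    of CompleteNormedModule R[i] H := {
  hdot : {dot H for @Num.conj R[i]};
  hdot_norm : forall x : H, `|x| ^+ 2 = hdot x x
}.

#[short(type="hilbertType")]
HB.structure Definition Hilbert (R : realType) :=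
  {H of CompleteNormedModule R[i] H & CompleteNormedModule_isHilbert R H}.

Definition separable_space (T : topologicalType) : Prop :=
  exists2 D : set T, countable D & dense D.

Section ComplexFunctions.
Variable R : realType.

Definition expi (t : R) : R[i] := cos t +i* sin t.

Definition principal_arg (z : R[i]) : R :=
  get [set t : R | - pi < t <= pi /\ z = `|z| * expi t].

Definition principal_log (z : R[i]) : R[i] :=
  ln (complex.Re `|z|) +i* principal_arg z.

(* The extrema of a set of complex numbers, for the partial order of R[i] in
   which x <= y means that y - x is a nonnegative real: they exist only if the
   set lies in R. *)
Definition max_set (A : set R[i]) : R :=
  get [set t : R | A t%:C /\ forall z, A z -> z <= t%:C].

Definition min_set (A : set R[i]) : R :=
  get [set t : R | A t%:C /\ forall z, A z -> t%:C <= z].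

End ComplexFunctions.

Section Operators.
Variables (R : realType) (H : hilbertType R).
Implicit Types (T S u w : H -> H).

Definition bounded_op T : Prop :=
  linear T /\ exists M : R[i], forall x, `|T x| <= M * `|x|.

Definition spec T : set R[i] :=
  [set l | ~ exists S, [/\ bounded_op S,
                           cancel (fun x => l *: x - T x) S &
                           cancel S (fun x => l *: x - T x)]].

Definition is_adjoint T S : Prop :=
  bounded_op S /\ forall x y, hdot (T x) y = hdot x (S y).

Definition adjoint T : H -> H := get (is_adjoint T).

Definition unitary_op u : Prop :=
  bounded_op u /\
  exists w, [/\ is_adjoint u w, cancel u w & cancel w u].

(* The *-polynomial p(z, w) = \sum_(j, k < n) c j k z^j w^k, evaluated at a
   complex number with w the conjugate of z, and at an operator with w its adjoint. *)
Definition starpoly (n : nat) (c : nat -> nat -> R[i]) (z : R[i]) : R[i] :=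
  \sum_(j < n) \sum_(k < n) c j k * z ^+ j * (Num.conj z) ^+ k.

Definition starpoly_op (n : nat) (c : nat -> nat -> R[i]) T : H -> H :=
  fun x => \sum_(j < n) \sum_(k < n) c j k *: iter j T (iter k (adjoint T) x).

(* Continuous functional calculus of a normal operator T: f(T) is the operator-norm
   limit of p(T, adjoint T) as the *-polynomials p tend to f uniformly on spec T. *)
Definition is_cfc T (f : R[i] -> R[i]) S : Prop :=
  bounded_op S /\
  forall e : R[i], 0 < e -> exists n c,
    (forall z, spec T z -> `|f z - starpoly n c z| <= e) /\
    (forall x, `|S x - starpoly_op n c T x| <= e * `|x|).

Definition cfc T (f : R[i] -> R[i]) : H -> H := get (is_cfc T f).

Definition log_op u : H -> H := cfc u (@principal_log R).

Definition theta_plus u : R := max_set (spec (fun x => - 'i%C *: log_op u x)).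

Definition theta_minus u : R := min_set (spec (fun x => - 'i%C *: log_op u x)).

Definition H_plus u : set H := [set xi | u xi = expi (theta_plus u) *: xi].

Definition H_minus u : set H := [set xi | u xi = expi (theta_minus u) *: xi].

End Operators.

(* Main.v *)
(** A unitary operator whose spectrum avoids the arc of the circle of centre [e^(ig)] and
    half-width [k] satisfies [Re <e^(-ig) u x, x> <= cos k |x|^2]. If [e^(it) x = u v x],
    then [y = v x] satisfies [u y = e^(it) v^* y], where the spectrum of [u] lies in the arc
    of angles [theta_-(u), theta_+(u)] and that of [e^(it) v^*] in the arc
    [t - theta_+(v), t - theta_-(v)]. For [t] outside of
    [theta_-(u) + theta_-(v), theta_+(u) + theta_+(v)] modulo [2 pi], the two arcs are
    separated by a chord, so that the numerical ranges are separated and [e^(it)] is not in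
    the spectrum of [u v]. For [t] equal to one of the two extreme values, the arcs share an
    end point; both quadratic forms are then extremal at [y], hence [y] is an eigenvector of
    [u] and of [v] for that end point.

    The angles [theta_+] and [theta_-] are the extreme arguments of the spectrum of [u]: the
    logarithm is the norm limit of
    [(u - u^-1)/2 sum_n a_n T^n], with [T = (2 - u - u^-1)/4 < 1], which comes from
    [theta = sin theta sum_n a_n sin^(2n)(theta/2)]. The spectra of functions of [u] are
    located by the estimate [min_(spec u) |P| |x| <= |P(u) x|] for polynomials [P]. *)

From HB Require Import structures.
Require Import Defs.
From mathcomp Require Import all_boot all_order all_algebra.
From mathcomp Require Import sesquilinear complex.
From mathcomp Require Import all_classical all_reals all_analysis.
From mathcomp Require Import ring lra.
Import Order.TTheory GRing.Theory Num.Theory.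
Import numFieldNormedType.Exports.
Local Open Scope classical_set_scope.
Local Open Scope ring_scope.
Local Open Scope complex_scope.

Set Implicit Arguments.
Unset Strict Implicit.
Unset Printing Implicit Defensive.

(** * Real-valued norms over the complex numbers *)

Section RealNorm.
Variables (R : realType) (V : normedZmodType R[i]).
Implicit Types x y : V.

(* The norm of a normed module over [R[i]] takes its values in [R[i]]; [rnorm] is its real
   version. *)
Definition rnorm x : R := complex.Re `|x|.

Lemma rnormE x : `|x| = (rnorm x)%:C.
Proof.
have := normr_ge0 x; rewrite lecE /rnorm => /andP[].
by case: `|x| => a b /= /eqP ->.
Qed.

Lemma rnorm_ge0 x : 0 <= rnorm x.
Proof. by rewrite -ler0c -rnormE normr_ge0. Qed.

Lemma rnorm_eq0 x : (rnorm x == 0) = (x == 0).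
Proof. by rewrite -(normr_eq0 x) rnormE (inj_eq (@complexI R) (rnorm x) 0). Qed.

Lemma rnorm0 : rnorm 0 = 0.
Proof. by apply/eqP; rewrite rnorm_eq0. Qed.

Lemma rnorm_gt0 x : (0 < rnorm x) = (x != 0).
Proof. by rewrite lt_neqAle rnorm_ge0 andbT eq_sym rnorm_eq0. Qed.

Lemma rnormN x : rnorm (- x) = rnorm x.
Proof. by rewrite /rnorm normrN. Qed.

Lemma rnormBC x y : rnorm (x - y) = rnorm (y - x).
Proof. by rewrite /rnorm distrC. Qed.

Lemma rnormD x y : rnorm (x + y) <= rnorm x + rnorm y.
Proof. by rewrite -lecR rmorphD /= -!rnormE ler_normD. Qed.

Lemma rnormB x y : rnorm (x - y) <= rnorm x + rnorm y.
Proof. by rewrite -[in leRHS](rnormN y) rnormD. Qed.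

Lemma rnorm_triangle z x y : rnorm (x - y) <= rnorm (x - z) + rnorm (z - y).
Proof. by rewrite -(subrKA z) rnormD. Qed.

End RealNorm.

Section ComplexNorm.
Variable R : realType.
Implicit Types z : R[i].

Lemma rnormM z z' : rnorm (z * z') = rnorm z * rnorm z'.
Proof. by apply: complexI; rewrite rmorphM -!rnormE normrM. Qed.

Lemma rnorm1 : rnorm (1 : R[i]) = 1.
Proof. by rewrite /rnorm normr1. Qed.

Lemma rnormX z n : rnorm (z ^+ n) = rnorm z ^+ n.
Proof. by elim: n => [|n IH]; rewrite ?expr0 ?rnorm1 // !exprS rnormM IH. Qed.

Lemma rnorm_sqr z : rnorm z ^+ 2 = complex.Re z ^+ 2 + complex.Im z ^+ 2.
Proof.
by apply: complexI; rewrite rmorphXn /= -rnormE add_Re2_Im2.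
Qed.

Lemma rnorm_real (a : R) : rnorm a%:C = `|a|.
Proof. by rewrite /rnorm normc_def /= expr0n addr0 sqrtr_sqr. Qed.

Lemma rnorm_i : rnorm ('i%C : R[i]) = 1.
Proof. by rewrite /rnorm normc_def /= expr0n add0r expr1n sqrtr1. Qed.

Lemma rnormZ (V : normedModType R[i]) z (x : V) : rnorm (z *: x) = rnorm z * rnorm x.
Proof. by apply: complexI; rewrite rmorphM /= -!rnormE normrZ. Qed.

End ComplexNorm.

(** * Geometric convergence in complete spaces *)

Section Sequences.
Variable R : realType.

Lemma geometric_small (rho C e : R) : 0 <= rho < 1 -> 0 < e ->
  exists N, forall n, (N <= n)%N -> C * rho ^+ n < e.
Proof.
move=> /andP[r0 r1] e0.
have h : (fun n => C * rho ^+ n) @ \oo --> (0 : R).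
  rewrite -[X in _ --> X](mulr0 C); apply: cvgMr.
  by apply: cvg_expr; rewrite ger0_norm.
have [N _ hN] := @cvgr_lt _ _ _ _ _ _ h e e0.
by exists N => n /hN.
Qed.

(** The increments are dominated by a geometric series, so the sequence is Cauchy. The explicit rate
    is kept because it later turns pointwise limits of operators into norm limits. *)
Lemma geometric_cvg (H : completeNormedModType R[i]) (x_ : nat -> H) (C rho : R) :
  0 <= rho < 1 -> (forall n, rnorm (x_ n.+1 - x_ n) <= C * rho ^+ n) ->
  exists l, forall n, rnorm (x_ n - l) <= C / (1 - rho) * rho ^+ n.
Proof.
move=> rho01 hx; have /andP[r0 r1] := rho01.
have C0 : 0 <= C.
  by have := hx 0%N; rewrite expr0 mulr1; apply: le_trans; exact: rnorm_ge0.
set K := C / (1 - rho).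
have K0 : 0 <= K by rewrite divr_ge0 // subr_ge0 ltW.
have KC : K * (1 - rho) = C by rewrite /K divfK // lt0r_neq0 // subr_gt0.
(* The finite geometric sum is written in closed form, so that the induction step reduces to an
   identity. *)
have hd n m : rnorm (x_ (n + m)%N - x_ n) <= K * rho ^+ n * (1 - rho ^+ m).
  elim: m => [|m IH]; first by rewrite addn0 subrr rnorm0 expr0 subrr mulr0.
  rewrite addnS (le_trans (rnorm_triangle (x_ (n + m)%N) _ _)) //.
  rewrite (le_trans (lerD (hx _) IH)) // -KC exprD exprS.
  by rewrite le_eqVlt; apply/orP; left; apply/eqP; ring.
have hle n m : (n <= m)%N -> rnorm (x_ m - x_ n) <= K * rho ^+ n.
  move=> nm; rewrite -(subnKC nm) (le_trans (hd _ _)) //.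
  apply: ler_piMr; first by rewrite mulr_ge0 ?exprn_ge0.
  by rewrite gerBl exprn_ge0.
have cv : cvg (x_ @ \oo).
  apply: cauchy_cvg; apply: cauchy_exP => e e0.
  have ee : e = (complex.Re e)%:C.
    by move: e0; rewrite ltcE /=; case: e => a b /= /andP[/eqP -> _].
  have e0' : 0 < complex.Re e by rewrite -ltcR -ee.
  have [N hN] := geometric_small K rho01 e0'.
  exists (x_ N); exists N => // m /= Nm.
  rewrite -ball_normE /= rnormE ee ltcR rnormBC (le_lt_trans (hle _ _ Nm)) //.
  exact: hN.
exists (lim (x_ @ \oo)) => n; apply/ler_addgt0Pr => e e0.
have e0' : 0 < e%:C by rewrite ltcR.
have [N _ hN] := @cvgr_dist_lt _ _ _ _ _ _ _ cv e%:C e0'.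
have := hN (maxn N n) (leq_maxl _ _).
rewrite rnormE ltcR rnormBC => h.
rewrite (le_trans (rnorm_triangle (x_ (maxn N n)) _ _)) //.
by rewrite lerD ?(ltW h) // rnormBC hle // leq_maxr.
Qed.

End Sequences.

(** * The real part of the inner product *)

Section Dot.
Variables (R : realType) (H : hilbertType R).
Implicit Types x y z : H.

Definition rdot x y : R := complex.Re (hdot x y).

Lemma ReD (a b : R[i]) : complex.Re (a + b) = complex.Re a + complex.Re b.
Proof. by case: a => ? ?; case: b. Qed.

Lemma ReN (a : R[i]) : complex.Re (- a) = - complex.Re a.
Proof. by case: a. Qed.

Lemma ReMr (a : R) (b : R[i]) : complex.Re (a%:C * b) = a * complex.Re b.
Proof. by case: b => b c /=; rewrite mul0r subr0. Qed.

Lemma hdotC x y : hdot x y = Num.conj (hdot y x).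
Proof. by rewrite (hermC hdot x y) expr0 mul1r. Qed.

Lemma rdotC x y : rdot x y = rdot y x.
Proof. by rewrite /rdot hdotC; case: (hdot y x). Qed.

Lemma rdotDl x y z : rdot (x + y) z = rdot x z + rdot y z.
Proof. by rewrite /rdot linearDl ReD. Qed.

Lemma rdotDr x y z : rdot z (x + y) = rdot z x + rdot z y.
Proof. by rewrite !(rdotC z) rdotDl. Qed.

Lemma rdotNl x z : rdot (- x) z = - rdot x z.
Proof. by rewrite /rdot linearNl ReN. Qed.

Lemma rdotNr x z : rdot z (- x) = - rdot z x.
Proof. by rewrite !(rdotC z) rdotNl. Qed.

Lemma rdotBl x y z : rdot (x - y) z = rdot x z - rdot y z.
Proof. by rewrite rdotDl rdotNl. Qed.

Lemma rdotBr x y z : rdot z (x - y) = rdot z x - rdot z y.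
Proof. by rewrite rdotDr rdotNr. Qed.

Lemma rdotZl (a : R) x y : rdot (a%:C *: x) y = a * rdot x y.
Proof. by rewrite /rdot linearZl_LR ReMr. Qed.

Lemma rdotZr (a : R) x y : rdot y (a%:C *: x) = a * rdot y x.
Proof. by rewrite !(rdotC y) rdotZl. Qed.

Lemma rdot0l x : rdot 0 x = 0.
Proof. by rewrite /rdot linear0l. Qed.

Lemma rdotZconj (a : R[i]) x y : rdot (a *: x) y = rdot x (Num.conj a *: y).
Proof. by rewrite /rdot linearZl_LR linearZr_LR /= conjCK. Qed.

Lemma rdotxx x : rdot x x = rnorm x ^+ 2.
Proof. by rewrite /rdot -hdot_norm rnormE -rmorphXn. Qed.

Lemma rnorm_sqrD x y : rnorm (x + y) ^+ 2 = rnorm x ^+ 2 + rnorm y ^+ 2 + rdot x y *+ 2.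
Proof. by rewrite -!rdotxx !(rdotDl, rdotDr) (rdotC y x) mulr2n; ring. Qed.

Lemma rnorm_sqrB x y : rnorm (x - y) ^+ 2 = rnorm x ^+ 2 + rnorm y ^+ 2 - rdot x y *+ 2.
Proof. by rewrite rnorm_sqrD rnormN rdotNr mulNrn. Qed.

(** Cauchy-Schwarz for the real part, by expanding the square of the norm of [|y| x - |x| y]. *)
Lemma rdot_le x y : rdot x y <= rnorm x * rnorm y.
Proof.
have [->|x0] := eqVneq x 0; first by rewrite rdot0l rnorm0 mul0r.
have {}x0 : 0 < rnorm x by rewrite rnorm_gt0.
have := sqr_ge0 (rnorm ((rnorm y)%:C *: x - (rnorm x)%:C *: y)).
rewrite rnorm_sqrB !rnormZ !rnorm_real !ger0_norm ?rnorm_ge0 // rdotZl rdotZr => h.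
have [y0|y0] := eqVneq (rnorm y) 0.
  by move/eqP: y0; rewrite rnorm_eq0 => /eqP ->; rewrite rdotC rdot0l rnorm0 mulr0.
have {}y0 : 0 < rnorm y by rewrite lt_neqAle eq_sym y0 rnorm_ge0.
rewrite -(ler_pM2l (mulr_gt0 x0 y0)) -subr_ge0.
by move: h; rewrite -mulr_natl => h; nra.
Qed.

Lemma rdot_norm_le x y : `|rdot x y| <= rnorm x * rnorm y.
Proof. by rewrite ler_norml rdot_le andbT lerNl -rdotNl -(rnormN x) rdot_le. Qed.

Lemma hdot_inj x y : (forall z, hdot z x = hdot z y) -> x = y.
Proof.
move=> h; apply/eqP; rewrite -subr_eq0 -rnorm_eq0 -sqrf_eq0 -rdotxx /rdot.
by rewrite linearBr /= h subrr.
Qed.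

End Dot.

Section LinearLemmas.
Variables (R : realType) (H : hilbertType R) (f : {linear H -> H}).

Lemma linB x y : f (x - y) = f x - f y.
Proof. exact: linearB. Qed.

Lemma linD x y : f (x + y) = f x + f y.
Proof. exact: linearD. Qed.

Lemma linZ a x : f (a *: x) = a *: f x.
Proof. exact: linearZ_LR. Qed.

End LinearLemmas.

(** * Bounded operators and the surjectivity of accretive ones *)

Section BoundedOperators.
Variables (R : realType) (H : hilbertType R).
Implicit Types B C T : {linear H -> H}.

Definition bounded_by (T : H -> H) (M : R) := forall x, rnorm (T x) <= M * rnorm x.

Definition bounded_below (T : H -> H) :=
  exists2 d : R, 0 < d & forall x, d * rnorm x <= rnorm (T x).

Lemma linear_pack (f : H -> H) : linear f -> exists F : {linear H -> H}, F = f :> (H -> H).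
Proof.
move=> hf; pose F : {linear H -> H} := HB.pack f (GRing.isLinear.Build _ _ _ _ f hf).
by exists F.
Qed.

Lemma bounded_opE T : bounded_op T <-> exists2 M, 0 < M & bounded_by T M.
Proof.
split=> [[_ [M hM]]|[M M0 hM]]; last first.
  by split; [exact: linearP|exists M%:C => x; rewrite !rnormE -rmorphM lecR].
have h x : rnorm (T x) <= complex.Re M * rnorm x.
  have := hM x; rewrite !rnormE lecE => /andP[_].
  by case: (M) => a b /=; rewrite mulr0 subr0.
exists (`|complex.Re M| + 1); first by rewrite ltr_wpDl.
move=> x; apply: le_trans (h x) _; apply: ler_wpM2r; first exact: rnorm_ge0.
by rewrite (le_trans (ler_norm _)) // lerDl.
Qed.

(** Lax-Milgram by iteration: in [x_(n+1) = x_n - t (B x_n - y)] the residual is multiplied by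
    [1 - t B]. With [t = d / K^2] one has [|r - t B r|^2 <= (1 - t d) |r|^2], a strict
    contraction. *)
Lemma accretive_surj B (M d : R) : 0 < d -> bounded_by B M ->
  (forall x, d * rnorm x ^+ 2 <= rdot (B x) x) -> forall y, exists x, B x = y.
Proof.
move=> d0 hM0 hd y.
(* Enlarging the bound to at least [d] gives [t d <= 1], so that [1 - t d] has a real square
   root. *)
pose K := Num.max d M.
have dK : d <= K by rewrite le_max lexx.
have K0 : 0 < K by apply: lt_le_trans dK.
have hM : bounded_by B K.
  by move=> x; rewrite (le_trans (hM0 x)) // ler_wpM2r ?rnorm_ge0 // le_max lexx orbT.
pose t := d / K ^+ 2.
have tK : t * K ^+ 2 = d by rewrite /t divfK // expf_neq0 // gt_eqF.
have t0 : 0 < t by rewrite divr_gt0 // exprn_gt0.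
pose q := 1 - t * d.
have td1 : t * d <= 1.
  by rewrite /t mulrAC ler_pdivrMr ?exprn_gt0 // mul1r -expr2 ler_sqr // nnegrE ltW.
have q01 : 0 <= q < 1 by rewrite subr_ge0 td1 /= gtrBl mulr_gt0.
have /andP[q0 q1] := q01.
pose k := Num.sqrt q.
have k01 : 0 <= k < 1.
  by rewrite sqrtr_ge0 /= -sqrtr1 ltr_sqrt.
have kk : k ^+ 2 = q by rewrite sqr_sqrtr.
have contr r : rnorm (r - t%:C *: B r) <= k * rnorm r.
  rewrite -ler_sqr ?nnegrE ?rnorm_ge0 ?mulr_ge0 ?sqrtr_ge0 ?rnorm_ge0 // exprMn kk.
  rewrite rnorm_sqrB rnormZ rnorm_real (ger0_norm (ltW t0)) rdotZr rdotC exprMn.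
  have h1 : rnorm (B r) ^+ 2 <= K ^+ 2 * rnorm r ^+ 2.
    by rewrite -exprMn ler_sqr ?nnegrE ?rnorm_ge0 ?mulr_ge0 ?rnorm_ge0 ?(ltW K0).
  have h2 := ler_wpM2l (ltW t0) (hd r).
  have h3 : t ^+ 2 * rnorm (B r) ^+ 2 <= t * (d * rnorm r ^+ 2).
    by rewrite (le_trans (ler_wpM2l (sqr_ge0 t) h1)) // -[in leRHS]tK; lra.
  by rewrite /q -mulr_natl; lra.
pose x_ := fix x_ n := if n is m.+1 then x_ m - t%:C *: (B (x_ m) - y) else 0.
pose r_ n := B (x_ n) - y.
have rS n : r_ n.+1 = r_ n - t%:C *: B (r_ n).
  by rewrite /r_ /= linearB linearZ /= addrAC.
have rk n : rnorm (r_ n) <= rnorm y * k ^+ n.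
  elim: n => [|n IH]; first by rewrite /r_ /= linear0 sub0r rnormN expr0 mulr1.
  rewrite rS (le_trans (contr _)) // exprS mulrCA ler_wpM2l //.
  by case/andP: k01.
have x_S n : rnorm (x_ n.+1 - x_ n) <= t * rnorm y * k ^+ n.
  rewrite addrAC subrr add0r rnormN rnormZ rnorm_real (ger0_norm (ltW t0)) -mulrA.
  by apply: ler_wpM2l; [exact: ltW|exact: rk].
have [l hl] := geometric_cvg k01 x_S.
exists l; apply/eqP; rewrite -subr_eq0 -rnorm_eq0 eq_le rnorm_ge0 andbT.
apply/ler_addgt0Pr => e e0; rewrite add0r.
set L := t * rnorm y / (1 - k) in hl.
have [N hN] := geometric_small (K * L + rnorm y) k01 e0.
apply: le_trans (ltW (hN N (leqnn _))).
have -> : B l - y = r_ N - B (x_ N - l) by rewrite linearB /r_ opprB [RHS]addrC subrKA.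
rewrite (le_trans (rnormB _ _)) // mulrDl addrC lerD //.
by rewrite (le_trans (hM _)) // -mulrA ler_wpM2l // ltW.
Qed.

End BoundedOperators.

(** * Bounded inverses and positive operators *)

Section Invertibility.
Variables (R : realType) (H : hilbertType R).
Implicit Types T D : {linear H -> H}.

Definition onto (T : H -> H) := forall y, exists x, T x = y.

Lemma bounded_below_inj T : bounded_below T -> injective T.
Proof.
move=> [d d0 hd] x y e; apply/eqP; rewrite -subr_eq0 -rnorm_eq0 eq_le rnorm_ge0 andbT.
by rewrite -(ler_pM2l d0) mulr0 (le_trans (hd _)) // linearB e subrr rnorm0.
Qed.

Lemma bounded_inverse T : bounded_below T -> onto T ->
  exists S, [/\ bounded_op S, cancel T S & cancel S T].
Proof.
move=> bT sT; have inj := bounded_below_inj bT.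
have [S hS] := choice sT.
have linS : linear S by move=> a x y; apply: inj; rewrite linearP !hS.
exists S; split=> [|x|//]; last by apply: inj; rewrite hS.
have [S' eS] := linear_pack linS; rewrite -eS; apply/bounded_opE.
have [d d0 hd] := bT; exists d^-1; first by rewrite invr_gt0.
by move=> x; rewrite ler_pdivlMl // (le_trans (hd _)) // eS hS.
Qed.

(** A bound for the inverse and a lower bound for the operator are reciprocal. Splitting
    invertibility this way isolates surjectivity, which for polynomials in a unitary follows from
    the lower bound. *)
Lemma not_specP T l : ~ spec T l <->
  bounded_below (fun x => l *: x - T x) /\ onto (fun x => l *: x - T x).
Proof.
have linT : linear (fun x => l *: x - T x).
  by move=> a x y; rewrite (linearP T) scalerDr scalerBr !scalerA (mulrC a) opprD addrACA.
have [T' eT] := linear_pack linT; rewrite /spec -eT; split=> [/contrapT[S [bS TS ST]]|].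
  have [linS _] := bS.
  have [S' eS] := linear_pack linS; move: bS; rewrite -eS => /bounded_opE[M M0 hM].
  split=> [|y]; last by exists (S y); rewrite eT; exact: ST.
  exists M^-1; first by rewrite invr_gt0.
  by move=> x; rewrite ler_pdivrMl // (le_trans _ (hM _)) // eS eT TS.
move=> [bT sT] h; apply: h; have [S [bS]] := bounded_inverse bT sT.
by rewrite eT => TS ST; exists S.
Qed.

(** Positivity of the form at [x - M^-1 D x] gives the estimate. In particular a vector at which the
    quadratic form of [D] vanishes lies in the kernel of [D]. *)
Lemma positive_bound D (M : R) : 0 < M -> bounded_by D M ->
  (forall x y, rdot (D x) y = rdot x (D y)) -> (forall x, 0 <= rdot (D x) x) ->
  forall x, rnorm (D x) ^+ 2 <= M * rdot (D x) x.
Proof.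
move=> M0 hM sym pos x.
have := pos (x - (M^-1)%:C *: D x).
rewrite linearB linearZ /= !(rdotBl, rdotBr) !(rdotZl, rdotZr) (sym (D x) x) rdotxx => h.
have h1 : rdot (D (D x)) (D x) <= M * rnorm (D x) ^+ 2.
  by rewrite (le_trans (rdot_le _ _)) // expr2 mulrA ler_wpM2r ?rnorm_ge0.
have i0 : 0 < M^-1 by rewrite invr_gt0.
have h2 := ler_wpM2l (ltW i0) (ler_wpM2l (ltW i0) h1).
rewrite (mulrA _ M) mulVf ?gt_eqF // mul1r in h2.
by rewrite -(ler_pM2l i0) (mulrA _ M) mulVf ?gt_eqF // mul1r; lra.
Qed.

End Invertibility.

(** * Polynomials in an operator *)

Section PolynomialCalculus.
Variables (R : realType) (H : hilbertType R).
Implicit Types (u F : {linear H -> H}) (P Q : {poly R[i]}).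

Definition polyop (u : {linear H -> H}) P (x : H) : H :=
  \sum_(i < size P) P`_i *: iter i u x.

Lemma iter_linear u n : linear (iter n u).
Proof. by elim: n => [//|n IH] a x y; rewrite !iterS IH linearP. Qed.

Lemma polyop_linear u P : linear (polyop u P).
Proof.
move=> a x y; rewrite /polyop scaler_sumr -big_split; apply: eq_bigr => i _ /=.
by rewrite iter_linear scalerDr !scalerA mulrC.
Qed.

HB.instance Definition _ u P :=
  GRing.isLinear.Build R[i] H H *:%R (polyop u P) (polyop_linear u P).

Lemma polyopE u P n x : (size P <= n)%N -> polyop u P x = \sum_(i < n) P`_i *: iter i u x.
Proof.
move=> sn; rewrite /polyop (big_ord_widen n (fun i => P`_i *: iter i u x) sn) big_mkcond.
apply: eq_bigr => i _; case: ltnP => // h.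
by rewrite nth_default // scale0r.
Qed.

Lemma polyop_lin u (a : R[i]) P Q x :
  polyop u (a *: P + Q) x = a *: polyop u P x + polyop u Q x.
Proof.
pose n := maxn (size (a *: P + Q)) (maxn (size P) (size Q)).
rewrite !(@polyopE _ _ n) ?leq_max ?leqnn ?orbT //.
rewrite scaler_sumr -big_split; apply: eq_bigr => i _ /=.
by rewrite coefD coefZ scalerDl scalerA.
Qed.

Lemma polyop0 u x : polyop u 0 x = 0.
Proof. by rewrite /polyop size_poly0 big_ord0. Qed.

Lemma polyopD u P Q x : polyop u (P + Q) x = polyop u P x + polyop u Q x.
Proof. by rewrite -[P]scale1r polyop_lin !scale1r. Qed.

Lemma polyopZ u (a : R[i]) P x : polyop u (a *: P) x = a *: polyop u P x.
Proof. by rewrite -[a *: P]addr0 polyop_lin polyop0 addr0. Qed.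

Lemma polyopB u P Q x : polyop u (P - Q) x = polyop u P x - polyop u Q x.
Proof. by rewrite -scaleN1r polyopD polyopZ scaleN1r. Qed.

Lemma polyop_sum u (I : Type) (r : seq I) (F : I -> {poly R[i]}) x :
  polyop u (\sum_(i <- r) F i) x = \sum_(i <- r) polyop u (F i) x.
Proof.
elim: r => [|i r IH]; first by rewrite !big_nil polyop0.
by rewrite !big_cons polyopD IH.
Qed.

Lemma polyop_mulX u P x : polyop u (P * 'X) x = u (polyop u P x).
Proof.
rewrite (@polyopE _ _ (size P).+1); last first.
  by rewrite (leq_trans (size_polyMleq _ _)) // size_polyX addn2.
rewrite big_ord_recl coefMX /= scale0r add0r linear_sum.
by apply: eq_bigr => i _; rewrite coefMX /= linearZ.
Qed.

Lemma polyopC u c x : polyop u c%:P x = c *: x.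
Proof. by rewrite (@polyopE _ _ 1) ?size_polyC_leq1 // big_ord1 coefC. Qed.

Lemma polyopX u x : polyop u 'X x = u x.
Proof. by rewrite -[X in polyop _ X]mul1r polyop_mulX polyopC scale1r. Qed.

Lemma polyopXn u n x : polyop u 'X^n x = iter n u x.
Proof.
elim: n => [|n IH]; first by rewrite expr0 polyopC scale1r.
by rewrite exprSr polyop_mulX IH.
Qed.

Lemma polyop_comm u F P x : (forall y, F (u y) = u (F y)) ->
  F (polyop u P x) = polyop u P (F x).
Proof.
move=> h; rewrite /polyop linear_sum; apply: eq_bigr => i _ /=; rewrite linearZ /=.
by congr (_ *: _); elim: (i : nat) => //= n IH; rewrite h IH.
Qed.

Lemma polyopM u P Q x : polyop u (P * Q) x = polyop u P (polyop u Q x).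
Proof.
elim/poly_ind: P x => [|P c IH] x; first by rewrite mul0r !polyop0.
have -> : (P * 'X + c%:P) * Q = P * Q * 'X + c *: Q by rewrite mulrDl mulrAC mul_polyC.
by rewrite !polyopD !polyop_mulX polyopZ polyopC IH.
Qed.

Lemma polyop_bounded u P M : bounded_by u M ->
  exists2 M', 0 < M' & bounded_by (polyop u P) M'.
Proof.
move=> hM; pose K := `|M| + 1.
have K0 : 0 < K by rewrite ltr_wpDl.
have hK : bounded_by u K.
  move=> x; rewrite (le_trans (hM x)) // ler_wpM2r ?rnorm_ge0 //.
  by rewrite (le_trans (ler_norm _)) // lerDl.
elim/poly_ind: P => [|P c [M' M0 IH]].
  by exists 1 => // x; rewrite polyop0 rnorm0 mul1r rnorm_ge0.
exists (K * M' + rnorm c).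
  by rewrite ltr_pwDl ?mulr_gt0 ?rnorm_ge0.
move=> x; rewrite polyopD polyop_mulX polyopC (le_trans (rnormD _ _)) // mulrDl rnormZ.
by rewrite lerD2r (le_trans (hK _)) // -mulrA ler_wpM2l // ltW.
Qed.

End PolynomialCalculus.

(** * Unitary operators: approximate eigenvalues and spectral lower bounds *)

Section Unitary.
Variables (R : realType) (H : hilbertType R).
Implicit Types (u w : {linear H -> H}) (P Q : {poly R[i]}).

(** Bundled form of unitarity: [w] is both the inverse and the adjoint of [u], and the roles of the
    two linear maps can be exchanged. *)
Record unitary_pair u w : Prop := UnitaryPair {
  upK : cancel u w;
  upKr : cancel w u;
  up_hdot : forall x y, hdot (u x) y = hdot x (w y) }.

Lemma unitary_pairC u w : unitary_pair u w -> unitary_pair w u.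
Proof.
by move=> [uK wK uw]; split=> // x y; rewrite hdotC -uw -hdotC.
Qed.

Lemma up_rdot u w x y : unitary_pair u w -> rdot (u x) y = rdot x (w y).
Proof. by move=> h; rewrite /rdot (up_hdot h). Qed.

Lemma up_rnorm u w x : unitary_pair u w -> rnorm (u x) = rnorm x.
Proof.
move=> h; apply/eqP; rewrite -(eqrXn2 (n := 2)) ?rnorm_ge0 //.
by rewrite -!rdotxx (up_rdot _ _ h) (upK h).
Qed.

Lemma up_rnorm_iter u w n x : unitary_pair u w -> rnorm (iter n u x) = rnorm x.
Proof. by move=> h; elim: n => //= n IH; rewrite (up_rnorm _ h). Qed.

Lemma up_bounded u w : unitary_pair u w -> bounded_by u 1.
Proof. by move=> h x; rewrite (up_rnorm _ h) mul1r. Qed.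

Lemma up_iterK u w n : unitary_pair u w -> cancel (iter n u) (iter n w).
Proof. by move=> h; elim: n => [//|n IH x]; rewrite iterSr iterS (upK h) IH. Qed.

Lemma up_iter_sub u w n i x : unitary_pair u w -> (i <= n)%N ->
  iter (n - i) u x = iter n u (iter i w x).
Proof.
by move=> h ni; rewrite -{2}(subnK ni) iterD (up_iterK _ (unitary_pairC h)).
Qed.

Notation conjp P := (map_poly Num.conj P).

Lemma polyop_adj u w P x y : unitary_pair u w ->
  rdot (polyop u P x) y = rdot x (polyop w (conjp P) y).
Proof.
move=> h; elim/poly_ind: P x y => [|P c IH] x y.
  by rewrite rmorph0 !polyop0 rdot0l rdotC rdot0l.
rewrite rmorphD rmorphM /= map_polyX map_polyC /= !polyopD !polyop_mulX !polyopC.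
rewrite rdotDl rdotDr (up_rdot _ _ h) rdotZconj (polyop_comm (F := w)) //.
by rewrite IH.
Qed.

(** Normality of [P(u)]: polynomials in [u] and in [w] commute, so both squared norms are the same
    quadratic form. *)
Lemma polyop_normal u w P x : unitary_pair u w ->
  rnorm (polyop w (conjp P) x) = rnorm (polyop u P x).
Proof.
move=> h; have h' := unitary_pairC h.
apply/eqP; rewrite -(eqrXn2 (n := 2)) ?rnorm_ge0 //.
apply/eqP; rewrite -!rdotxx -(polyop_adj _ _ _ h) [RHS](polyop_adj _ _ _ h).
rewrite rdotC; congr (rdot _ _).
rewrite (polyop_comm (F := polyop u P)) // => y.
by rewrite (polyop_comm (F := w)) // => z; rewrite (upK h) (upKr h).
Qed.

(** By normality the adjoint of [P(u)] has the same lower bound [d], so the product of [P(u)] with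
    its adjoint is accretive with constant [d^2], hence onto. *)
Lemma polyop_onto u w P : unitary_pair u w -> bounded_below (polyop u P) -> onto (polyop u P).
Proof.
move=> h [d d0 hd] y.
have [M1 M10 hM1] := polyop_bounded P (up_bounded h).
have [M2 M20 hM2] := polyop_bounded (conjp P) (up_bounded (unitary_pairC h)).
pose B : {linear H -> H} := polyop u P \o polyop w (conjp P).
have bB : bounded_by B (M1 * M2).
  by move=> z /=; rewrite (le_trans (hM1 _)) // -mulrA ler_wpM2l // ltW.
have aB z : d ^+ 2 * rnorm z ^+ 2 <= rdot (B z) z.
  rewrite /= (polyop_adj _ _ _ h) rdotxx (polyop_normal _ _ h).
  by rewrite -exprMn ler_sqr ?nnegrE ?mulr_ge0 ?rnorm_ge0 // ltW.
have [z hz] := accretive_surj (exprn_gt0 2 d0) bB aB y.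
by exists (polyop w (conjp P) z).
Qed.

(** Every spectral value is an approximate eigenvalue: [z - u] is a polynomial in [u], so a lower
    bound would already make it invertible. *)
Lemma spec_unitaryP u w z : unitary_pair u w ->
  spec u z <-> forall e, 0 < e -> exists x, rnorm (u x - z *: x) < e * rnorm x.
Proof.
move=> h; split=> [sz e e0|ap].
  apply: contrapT => /forallNP hx; apply/not_specP : sz.
  have hb : bounded_below (polyop u (z%:P - 'X)).
    exists e => // x; rewrite polyopB polyopC polyopX rnormBC leNgt; exact/negP/hx.
  have ex : (fun x => z *: x - u x) = polyop u (z%:P - 'X).
    by apply/funext => x; rewrite polyopB polyopC polyopX.
  by rewrite ex; split=> //; exact: polyop_onto h hb.
apply: contrapT => /not_specP[[d d0 hd] _].
have [x] := ap d d0; rewrite rnormBC => hx.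
by have := lt_le_trans hx (hd x); rewrite ltxx.
Qed.

(** Since [u] is isometric, the reverse triangle inequality bounds [|u x - z x|] below by the
    distance of [|z|] to 1 times [|x|], which excludes approximate eigenvectors off the circle. *)
Lemma spec_circle u w z : unitary_pair u w -> spec u z -> rnorm z = 1.
Proof.
move=> h /(spec_unitaryP z h) sz; apply: contrapT => /eqP z1.
have e0 : 0 < `|rnorm z - 1| by rewrite normr_gt0 subr_eq0.
have [x] := sz _ e0; apply/negP; rewrite -leNgt.
rewrite -[X in _ * X]ger0_norm ?rnorm_ge0 // -normrM mulrBl mul1r -rnormZ -(up_rnorm x h).
rewrite ler_norml lerBlDr lerNl opprB lerBlDr; apply/andP; split.
  by rewrite addrC -lerBlDl -{1}(subrK (z *: x) (u x)) lerBlDr rnormD.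
by rewrite rnormBC -{1}(subrK (u x) (z *: x)) rnormD.
Qed.

(** Split [Q] into linear factors: a composition of operators bounded below is bounded below, so
    some factor [u - z] is not, and its root [z] is in the spectrum. *)
Lemma root_in_spec u w Q : unitary_pair u w -> Q != 0 -> ~ bounded_below (polyop u Q) ->
  exists2 z, root Q z & spec u z.
Proof.
move=> h Q0 hb; have [r Qr] := closed_field_poly_normal Q.
have lc0 : lead_coef Q != 0 by rewrite lead_coef_eq0.
suff [z zr sz] : exists2 z, z \in r & spec u z.
  by exists z => //; rewrite Qr rootZ // root_prod_XsubC.
have {hb} : ~ bounded_below (polyop u (\prod_(z <- r) ('X - z%:P))).
  move=> [d d0 hd]; apply: hb; exists (rnorm (lead_coef Q) * d).
    by rewrite mulr_gt0 ?rnorm_gt0.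
  by move=> x; rewrite {2}Qr polyopZ rnormZ -mulrA ler_wpM2l ?rnorm_ge0.
elim: r {Qr} => [|z r IH] hb.
  exfalso; apply: hb; exists 1 => // x.
  by rewrite big_nil polyopC scale1r mul1r.
have [sz|sz] := pselect (spec u z); first by exists z; rewrite ?mem_head.
have [|z' zr sz'] := IH; last by exists z'; rewrite // in_cons zr orbT.
move=> [d d0 hd]; apply: hb; move/not_specP: sz => [[e e0 he] _].
exists (e * d); first by rewrite mulr_gt0.
move=> x; rewrite big_cons polyopM polyopB polyopC polyopX rnormBC (le_trans _ (he _)) //.
by rewrite -mulrA ler_pM2l.
Qed.

(* On the unit circle, [sharp P] is [z^n conj (P z)]; on operators, [u^n P(u)^*]. *)
Definition sharp P := \sum_(i < size P) (Num.conj P`_i) *: 'X^(size P - i).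

Lemma polyop_sharp u w P x : unitary_pair u w ->
  polyop u (sharp P) x = iter (size P) u (polyop w (conjp P) x).
Proof.
move=> h; rewrite -polyopXn /sharp polyop_sum [polyop w _ _]/polyop linear_sum size_map_poly.
apply: eq_bigr => i _; rewrite polyopZ linearZ coef_map /= !polyopXn; congr (_ *: _).
by rewrite (up_iter_sub _ h) // ltnW.
Qed.

Lemma conj_circle (z : R[i]) : rnorm z = 1 -> z * Num.conj z = 1.
Proof. by move=> z1; rewrite -normCK rnormE z1 expr1n. Qed.

Lemma horner_sharp P (z : R[i]) : rnorm z = 1 ->
  (sharp P).[z] = z ^+ size P * Num.conj P.[z].
Proof.
move=> z1; rewrite /sharp horner_sum horner_coef rmorph_sum mulr_sumr.
apply: eq_bigr => i _; rewrite hornerZ hornerXn rmorphM rmorphXn /=.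
have -> : z ^+ size P = z ^+ (size P - i) * z ^+ i by rewrite -exprD subnK // ltnW.
by rewrite mulrACA -exprMn conj_circle // expr1n mulr1 mulrC.
Qed.

(* [m] is the infimum of [|P(u) x|^2 / |x|^2], so that [P(u)^* P(u) - m] is positive but not
   bounded below; [Q(u)] is its product with a power of [u]. *)
Lemma infimum_not_bounded_below u w P x0 : unitary_pair u w -> x0 != 0 ->
  exists m, [/\ 0 <= m, m * rnorm x0 ^+ 2 <= rnorm (polyop u P x0) ^+ 2 &
    let Q := sharp P * P - m%:C *: 'X^(size P) in
    ~ bounded_below (polyop u Q)].
Proof.
move=> h x00.
pose A := [set rnorm (polyop u P x) ^+ 2 / rnorm x ^+ 2 | x in [set x | x != 0]].
have A0 : A (rnorm (polyop u P x0) ^+ 2 / rnorm x0 ^+ 2) by exists x0.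
have lbA : lbound A 0 by move=> _ [x _ <-]; rewrite divr_ge0 ?sqr_ge0.
have hA : has_inf A by split; [exists (rnorm (polyop u P x0) ^+ 2 / rnorm x0 ^+ 2)|exists 0].
pose m := inf A.
have m_le x : m * rnorm x ^+ 2 <= rnorm (polyop u P x) ^+ 2.
  have [->|xn0] := eqVneq x 0; first by rewrite rnorm0 expr0n mulr0 sqr_ge0.
  rewrite -ler_pdivlMr ?exprn_gt0 ?rnorm_gt0 //; apply: ge_inf; first by exists 0.
  by exists x.
have m0 : 0 <= m by apply: lb_le_inf => //; exists (rnorm (polyop u P x0) ^+ 2 / rnorm x0 ^+ 2).
exists m; split=> // Q [d d0 hd].
have linD : linear (fun x => polyop w (conjp P) (polyop u P x) - m%:C *: x).
  move=> a x y; rewrite (linearP (polyop u P)) (linearP (polyop w _)).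
  by rewrite scalerDr opprD addrACA scalerBr !scalerA (mulrC a).
have [D eD] := linear_pack linD.
have DE x : D x = polyop w (conjp P) (polyop u P x) - m%:C *: x by rewrite eD.
have rD x y : rdot (D x) y = rdot (polyop u P x) (polyop u P y) - m * rdot x y.
  by rewrite DE rdotBl rdotZl (rdotC _ y) -(polyop_adj _ _ _ h) (rdotC _ (polyop u P x)).
have QD x : rnorm (polyop u Q x) = rnorm (D x).
  rewrite polyopB polyopM (polyop_sharp _ _ h) polyopZ polyopXn.
  rewrite -(up_rnorm_iter (size P) (D x) h) DE.
  by rewrite -!(polyopXn u (size P)) linearB; congr (rnorm (_ - _)); rewrite linearZ.
have [M1 M10 hM1] := polyop_bounded P (up_bounded h).
have [M2 M20 hM2] := polyop_bounded (conjp P) (up_bounded (unitary_pairC h)).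
have bD : bounded_by D (M2 * M1 + m).
  move=> x; rewrite DE (le_trans (rnormB _ _)) // mulrDl lerD //.
    by rewrite (le_trans (hM2 _)) // -mulrA ler_wpM2l // ltW.
  by rewrite rnormZ rnorm_real ger0_norm.
have M0 : 0 < M2 * M1 + m by rewrite ltr_pwDl ?mulr_gt0.
have key x := positive_bound M0 bD _ _ x.
set M := M2 * M1 + m in M0 key.
(* A lower bound [d] for [Q(u)] would give [d^2 |x|^2 <= |D x|^2 <= M (|P(u) x|^2 - m |x|^2)], so
   every quotient would exceed [m] by at least [d^2 / M], against the choice of the infimum. *)
have e0 : 0 < d ^+ 2 / M by rewrite divr_gt0 // exprn_gt0.
have [_ [x x0' <-]] := inf_adherent e0 hA.
apply/negP; rewrite -leNgt -/m ler_pdivlMr ?exprn_gt0 ?rnorm_gt0 // mulrDl.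
have : rnorm (D x) ^+ 2 <= M * rdot (D x) x.
  apply: key => [y z|y].
    by rewrite rD (rdotC y (D z)) rD (rdotC z y) (rdotC (polyop u P z)).
  by rewrite rD !rdotxx subr_ge0.
rewrite rD !rdotxx -lerBrDl => hh.
rewrite mulrAC ler_pdivrMr // [leRHS]mulrC (le_trans _ hh) // -QD -exprMn.
by rewrite ler_sqr ?nnegrE ?mulr_ge0 ?rnorm_ge0 // ltW.
Qed.

(** Consequently the roots on the unit circle of the polynomial in [infimum_not_bounded_below] are
    the points where [|P|^2 = m]. *)
Lemma horner_sharp_sub P (m : R) (z : R[i]) : rnorm z = 1 ->
  (sharp P * P - m%:C *: 'X^(size P)).[z] = z ^+ size P * (rnorm P.[z] ^+ 2 - m)%:C.
Proof.
move=> z1; rewrite hornerD hornerN hornerM hornerZ hornerXn horner_sharp //.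
by rewrite -mulrA [_^* * _]mulrC -normCK rnormE rmorphB rmorphXn mulrBr [_ * m%:C]mulrC.
Qed.

(** Take [P = X - 1]. If [Q] is not zero, one of its roots is in the spectrum; if [Q] were zero,
    [|z - 1|^2 = m] would hold at both [z = 1] and [z = -1], giving [m = 0] and [m = 4]. *)
Lemma spec_nonempty u w : unitary_pair u w -> (exists x : H, x != 0) ->
  exists z, spec u z.
Proof.
move=> h [x x0]; pose P : {poly R[i]} := 'X - 1%:P.
have [m [m0 _]] := infimum_not_bounded_below P h x0.
set Q := _ - _ => hb.
have [Q0|Q0] := eqVneq Q 0; last by have [z _] := root_in_spec h Q0 hb; exists z.
have n1 : rnorm (1 : R[i]) = 1 by exact: rnorm1.
have nN1 : rnorm (-1 : R[i]) = 1 by rewrite rnormN rnorm1.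
have := horner_sharp_sub P m n1; have := horner_sharp_sub P m nN1.
rewrite -/Q Q0 !horner0 !hornerXsubC subrr rnorm0 expr1n mul1r expr0n sub0r.
move=> /esym/eqP; rewrite mulf_eq0 signr_eq0 => /eqP.
rewrite -opprD rnormN -(natrD _ 1 1) => /(@complexI R _ 0) e1 /esym/(@complexI R _ 0) e2.
have n2 : rnorm (2%:R : R[i]) = 2%:R.
  by rewrite -(rmorph_nat (real_complex R)) rnorm_real ger0_norm.
by move: e1 e2; rewrite n2; lra.
Qed.

(** The infimum [m] equals [|P z|^2] for some spectral [z], a root of [Q], hence [m >= d^2]. When
    [Q] is zero any spectral point serves as the root. *)
Lemma polyop_lower_bound u w P (d : R) : unitary_pair u w -> 0 <= d ->
  (forall z, spec u z -> d <= rnorm P.[z]) -> forall x, d * rnorm x <= rnorm (polyop u P x).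
Proof.
move=> h d0 hd x; have [->|x0] := eqVneq x 0; first by rewrite rnorm0 mulr0 rnorm_ge0.
have [m [m0 hm]] := infimum_not_bounded_below P h x0.
set Q := _ - _ => hb.
have [z Qz sz] : exists2 z, root Q z & spec u z.
  have [Q0|Q0] := eqVneq Q 0; last exact: (root_in_spec h Q0 hb).
  have [|z sz] := spec_nonempty h; first by exists x.
  by exists z; rewrite // Q0 root0.
have z1 := spec_circle h sz.
move: Qz; rewrite /root horner_sharp_sub // mulf_eq0 expf_eq0 -rnorm_eq0 z1 oner_eq0 andbF /=.
rewrite (inj_eq (@complexI R) _ 0) subr_eq0 => /eqP e.
rewrite -ler_sqr ?nnegrE ?mulr_ge0 ?rnorm_ge0 // exprMn (le_trans _ hm) //.
rewrite ler_wpM2r ?sqr_ge0 // -e ler_sqr ?nnegrE ?rnorm_ge0 //; exact: hd.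
Qed.

End Unitary.

(** * Angles on the unit circle *)

Section Angles.
Variable R : realType.
Implicit Types (a b t : R) (z : R[i]).

Lemma rnorm_expi t : rnorm (expi t) = 1.
Proof.
apply/eqP; rewrite -(eqrXn2 (n := 2)) ?rnorm_ge0 //.
by rewrite rnorm_sqr cos2Dsin2 expr1n.
Qed.

Lemma expi_eq z t : complex.Re z = cos t -> complex.Im z = sin t -> z = expi t.
Proof. by case: z => a b /= -> ->. Qed.

Lemma expiD a b : expi (a + b) = expi a * expi b.
Proof. by apply/esym/expi_eq => /=; rewrite ?cosD ?sinD // addrC. Qed.

Lemma expiN t : expi (- t) = Num.conj (expi t).
Proof. by apply/esym/expi_eq => /=; rewrite ?cosN ?sinN. Qed.

Lemma expi0 : expi 0 = 1 :> R[i].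
Proof. by apply/esym/expi_eq; rewrite /= ?cos0 ?sin0. Qed.

Lemma expipi : expi pi = -1 :> R[i].
Proof. by apply/esym/expi_eq; rewrite /= ?cospi ?sinpi ?oppr0. Qed.

Lemma expiD2pi t : expi (t + pi *+ 2) = expi t.
Proof. by rewrite /expi cosD2pi sinD2pi. Qed.

Lemma expiB2pi t : expi (t - pi *+ 2) = expi t.
Proof. by rewrite -expiD2pi subrK. Qed.

Lemma expiNM t : expi (- t) * expi t = 1.
Proof. by rewrite -expiD addNr expi0. Qed.

Lemma rnorm_expiB a b : rnorm (expi a - expi b) ^+ 2 = 2 - cos (a - b) *+ 2.
Proof.
rewrite rnorm_sqr /= cosB -mulr_natr.
by have := cos2Dsin2 a; have := cos2Dsin2 b; nra.
Qed.

Lemma cos_eq1 t : `|t| < pi *+ 2 -> cos t = 1 -> t = 0.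
Proof.
move=> tpi ct; have e : t = (t / 2) *+ 2 by rewrite -mulr_natr divfK.
have : sin (t / 2) = 0.
  apply/eqP; rewrite -sqrf_eq0 sin2cos2.
  by move: ct; rewrite {1}e cos_mulr2n -mulr_natr => ct; apply/eqP; lra.
move: tpi; rewrite (mulr2n pi) => tpi.
have [t0|t0|//] := ltgtP t 0 => s.
  have : 0 < sin (- (t / 2)).
    by move: tpi; rewrite ltr0_norm // => tpi; apply: sin_gt0_pi; apply/andP; split; lra.
  by rewrite sinN s oppr0 ltxx.
have : 0 < sin (t / 2).
  by move: tpi; rewrite gtr0_norm // => tpi; apply: sin_gt0_pi; apply/andP; split; lra.
by rewrite s ltxx.
Qed.

Lemma expi_inj a b : `|a - b| < pi *+ 2 -> expi a = expi b -> a = b.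
Proof.
move=> ab e; apply/eqP; rewrite -subr_eq0; apply/eqP/cos_eq1 => //.
by have := rnorm_expiB a b; rewrite e subrr rnorm0 expr0n (mulr2n (cos _)) /= => ?; lra.
Qed.

Lemma circle_expi z : rnorm z = 1 -> exists2 t, - pi < t <= pi & z = expi t.
Proof.
case: z => a b z1; have ab : a ^+ 2 + b ^+ 2 = 1.
  by rewrite -(rnorm_sqr (a +i* b)) z1 expr1n.
have a1 : -1 <= a <= 1 by apply/andP; split; nra.
have ca : cos (acos a) = a by rewrite acosK // in_itv.
have sa : sin (acos a) = `|b|.
  by rewrite sin_acos // -ab addrAC subrr add0r sqrtr_sqr.
have [b0|b0] := leP 0 b.
  exists (acos a); last by apply: expi_eq; rewrite /= ?ca ?sa ?ger0_norm.
  by rewrite acos_lepi // andbT (lt_le_trans _ (acos_ge0 a1)) // oppr_lt0 pi_gt0.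
exists (- acos a); last first.
  by apply: expi_eq; rewrite /= ?cosN ?sinN ?ca ?sa ?ltr0_norm ?opprK.
rewrite ltrN2 acos_ltpi /=; last by apply/andP; split; nra.
by rewrite (le_trans _ (pi_ge0 R)) // oppr_le0 acos_ge0.
Qed.

Lemma circle_expi_center g z : rnorm z = 1 ->
  exists2 t, - pi < t - g <= pi & z = expi t.
Proof.
move=> z1; have [|t ht e] := @circle_expi (z * expi (- g)).
  by rewrite rnormM rnorm_expi mulr1.
exists (t + g); first by rewrite addrK.
by rewrite expiD -e -mulrA expiNM mulr1.
Qed.

Lemma cos_le_center h t : 0 <= h -> h <= `|t| <= pi -> cos t <= cos h.
Proof.
move=> h0 /andP[ht tpi]; rewrite -(cos_norm t) leNgt; apply/negP => hlt.
move: hlt; rewrite ltr_cos ?in_itv /= ?normr_ge0 ?h0 //.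
  by rewrite ltNge ht.
exact: le_trans tpi.
Qed.

Lemma expi_continuous (e : R) : 0 < e ->
  exists2 d, 0 < d & forall a b, `|a - b| < d -> rnorm (expi a - expi b) < e.
Proof.
move=> e0; have e2 : 0 < e ^+ 2 / 2 by rewrite divr_gt0 ?exprn_gt0.
have /cvgrPdist_lt /(_ _ e2) [d /= d0 hd] := @continuous_cos R 0.
exists d => // a b ab; rewrite -ltr_sqr ?nnegrE ?rnorm_ge0 ?(ltW e0) // rnorm_expiB.
have := hd (a - b); rewrite /= sub0r normrN cos0 => /(_ ab).
by rewrite ltr_norml -mulr_natr => /andP[_]; lra.
Qed.

End Angles.

(** * Polynomial approximation of the argument *)

Section ArgApproximation.
Variable R : realType.

(* The coefficients of [asin s / sqrt (1 - s^2)], that is [4^n n!^2 / (2n+1)!]. *)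
Fixpoint asin_coeff (n : nat) : R :=
  if n is m.+1 then asin_coeff m * (m.*2.+2%:R / m.*2.+3%:R) else 1.

Lemma asin_coeff_bound n : 0 <= asin_coeff n <= 1.
Proof.
elim: n => [|n /andP[IH0 IH1]]; first by rewrite /= ler01 lexx.
have h : 0 <= (n.*2.+2%:R / n.*2.+3%:R : R) <= 1.
  by rewrite divr_ge0 //= ler_pdivrMr // mul1r ler_nat.
case/andP: h => h0 h1; rewrite /= mulr_ge0 //=.
by rewrite -[leRHS]mulr1 ler_pM.
Qed.

(** Truncation error of [asin s = sqrt (1 - s^2) sum_k a_k s^(2k+1)] at [s = sin x], with [cos x] in
    place of the root so that it is smooth in [x]. *)
Definition asin_err (N : nat) (x : R) : R :=
  (\sum_(k < N) asin_coeff k * sin x ^+ k.*2.+1) * cos x - x.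

Lemma asin_errS N x :
  asin_err N.+1 x = asin_err N x + asin_coeff N * (sin x ^+ N.*2.+1 * cos x).
Proof. by rewrite /asin_err big_ord_recr /=; ring. Qed.

(* The derivative telescopes, since [(2n + 3) a_(n+1) = (2n + 2) a_n]. *)
Lemma is_derive_asin_err N (x : R) :
  is_derive x (1 : R) (asin_err N) (- (asin_coeff N * N.*2.+1%:R * sin x ^+ N.*2)).
Proof.
elim: N => [|N IH].
  have -> : asin_err 0 = - (@id R).
    by apply/funext => y; rewrite /asin_err big_ord0 mul0r sub0r.
  by apply: is_derive_eq; rewrite /= expr0 !mulr1.
have -> : asin_err N.+1 =
    asin_err N + asin_coeff N *: ((sin ^+ N.*2.+1) * cos).
  by apply/funext => y; rewrite asin_errS !fctE.
have dX := is_deriveX N.*2.+1 (is_derive_sin x).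
have dM := is_deriveM dX (is_derive_cos x).
apply: (is_derive_eq (is_deriveD IH (is_deriveZ (asin_coeff N) dM))).
have c2 := cos2sin2 x; rewrite expr2 in c2.
have e : asin_coeff N.+1 * N.+1.*2.+1%:R = asin_coeff N * N.*2.+2%:R.
  by rewrite /= doubleS -mulrA divfK // pnatr_eq0.
rewrite e !fctE /GRing.scale /= doubleS !exprS -[N.*2.+2%:R]natr1.
set p := sin x ^+ N.*2; set k : R := N.*2.+1%:R.
have -> : cos x * (k * p * cos x) = k * p * (1 - sin x ^+ 2) by rewrite -c2; ring.
by ring.
Qed.

Lemma asin_errN N x : asin_err N (- x) = - asin_err N x.
Proof.
rewrite /asin_err cosN opprD -mulNr -sumrN; congr (_ * _ - _).
by apply: eq_bigr => k _; rewrite sinN exprNn -signr_odd /= odd_double expr1 mulN1r mulrN.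
Qed.

(** Oddness reduces to [x >= 0]; then the mean value theorem applies from [0], where the error
    vanishes. The factor 2 bounds [pi / 2], and [sin] is increasing up to there. *)
Lemma asin_err_bound N x : `|x| <= pi / 2 ->
  `|asin_err N x| <= 2 * (N.*2.+1%:R * (sin x ^+ 2) ^+ N).
Proof.
wlog x0 : x / 0 <= x.
  move=> hw; have [/hw//|x0] := leP 0 x; rewrite -normrN => /hw.
  by rewrite asin_errN normrN sinN sqrrN; apply; rewrite oppr_ge0 ltW.
rewrite ger0_norm // => xpi.
have [] := @MVT_segment R (asin_err N)
   (fun x => - (asin_coeff N * N.*2.+1%:R * sin x ^+ N.*2)) 0 x x0.
- by move=> y _; exact: is_derive_asin_err.
- apply: derivable_within_continuous => y _.
  by have [] := is_derive_asin_err N y.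
move=> c; rewrite in_itv /= => /andP[c0 cx].
have -> : asin_err N 0 = 0.
  rewrite /asin_err subr0 big1 ?mul0r // => k _.
  by rewrite sin0 expr0n mulr0.
rewrite !subr0 => ->; rewrite mulNr normrN normrM (ger0_norm x0) mulrC.
have x2 : x <= 2 by rewrite (le_trans xpi) // ltW // pihalf_lt2.
apply: ler_pM => //; rewrite ?normr_ge0 //.
have /andP[a0 a1] := asin_coeff_bound N.
rewrite -mulrA normrM (ger0_norm a0) -[leRHS]mul1r ler_pM ?normr_ge0 //.
rewrite normrM ger0_norm // ler_wpM2l // -mul2n exprM normrX ger0_norm ?sqr_ge0 //.
rewrite lerXn2r ?nnegrE ?sqr_ge0 //.
have pi20 : 0 <= pi / 2 :> R by rewrite divr_ge0 ?pi_ge0.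
have sc : 0 <= sin c by apply: sin_ge0_pi; rewrite c0 /=; have := pi_ge0 R; lra.
have sx : 0 <= sin x by apply: sin_ge0_pi; rewrite x0 /=; have := pi_ge0 R; lra.
rewrite ler_sqr ?nnegrE // leNgt ltr_sin ?in_itv /=; last 2 first.
- by apply/andP; split; lra.
- by apply/andP; split; lra.
by rewrite -leNgt.
Qed.

(** With [s = sqrt rho], one factor [s^n] absorbs the linear growth, as [(n + 1) s^n <= sum_(k <= n)
    s^k <= 1 / (1 - s)]; the other factor [s^n] tends to 0. *)
Lemma poly_geometric_small (rho e : R) : 0 <= rho < 1 -> 0 < e ->
  exists N, forall n, (N <= n)%N -> n.*2.+1%:R * rho ^+ n <= e.
Proof.
move=> /andP[r0 r1] e0; pose s := Num.sqrt rho.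
have s0 : 0 <= s := sqrtr_ge0 _.
have s1 : s < 1 by rewrite -sqrtr1 ltr_sqrt.
have ss : s ^+ 2 = rho by rewrite sqr_sqrtr.
have bd n : n.+1%:R * s ^+ n <= (1 - s)^-1.
  rewrite -[leRHS]mul1r ler_pdivlMr ?subr_gt0 //.
  have -> : n.+1%:R * s ^+ n = \sum_(k < n.+1) s ^+ n.
    by rewrite sumr_const card_ord mulr_natl.
  apply: (@le_trans _ _ ((\sum_(k < n.+1) s ^+ k) * (1 - s))).
    rewrite ler_wpM2r ?subr_ge0 ?(ltW s1) //; apply: ler_sum => k _.
    by apply: ler_wiXn2l => //; [exact: ltW|rewrite -ltnS].
  by rewrite mulrC -opprB mulNr -subrX1 opprB gerBl exprn_ge0.
have [|N hN] := @geometric_small R s (2 / (1 - s)) e _ e0; first by rewrite s0.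
exists N => n /hN/ltW; apply: le_trans.
rewrite -ss -exprM mul2n -addnn exprD mulrA ler_wpM2r ?exprn_ge0 //.
rewrite (le_trans _ (ler_wpM2l _ (bd n))) // mulrA ler_wpM2r ?exprn_ge0 //.
by rewrite -natrM ler_nat mul2n -addnn addSn ltnS leq_add2l.
Qed.

(** In terms of [x = t / 2] the difference is [2 asin_err n x], and the condition on [rho] reads
    [sin^2 x <= rho]: it keeps [t] away from [pi] and [-pi], which makes the approximation
    uniform. *)
Lemma arg_approx (rho e : R) : 0 <= rho < 1 -> 0 < e ->
  exists N, forall n t, (N <= n)%N -> `|t| <= pi -> (1 - cos t) / 2 <= rho ->
  `|sin t * (\sum_(k < n) asin_coeff k * ((1 - cos t) / 2) ^+ k) - t| <= e.
Proof.
move=> rho01 e0; have e4 : 0 < e / 4 by rewrite divr_gt0.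
have [N hN] := poly_geometric_small rho01 e4; exists N => n t /hN hn tpi trho.
pose x := t / 2; have tx : t = x *+ 2 by rewrite -mulr_natr divfK.
have sx : (1 - cos t) / 2 = sin x ^+ 2.
  by rewrite tx cos_mulr2n sin2cos2 -mulr_natr; field.
have -> : sin t * (\sum_(k < n) asin_coeff k * ((1 - cos t) / 2) ^+ k) - t
    = 2 * asin_err n x.
  rewrite sx /asin_err.
  have -> : \sum_(k < n) asin_coeff k * sin x ^+ k.*2.+1 =
      sin x * \sum_(k < n) asin_coeff k * (sin x ^+ 2) ^+ k.
    by rewrite mulr_sumr; apply: eq_bigr => k _; rewrite -exprM mul2n exprS mulrCA.
  by rewrite tx sin_mulr2n; ring.
have x2 : `|x| <= pi / 2.
  by rewrite /x normrM [X in _ * X]ger0_norm ?ler_pM2r ?invr_ge0 ?invr_gt0.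
rewrite normrM ger0_norm //.
have := asin_err_bound n x2.
have h : n.*2.+1%:R * (sin x ^+ 2) ^+ n <= n.*2.+1%:R * rho ^+ n.
  rewrite ler_wpM2l // lerXn2r ?nnegrE ?sqr_ge0 -?sx //.
  by case/andP: rho01.
lra.
Qed.

End ArgApproximation.

(** * Numerical ranges of unitaries whose spectrum avoids an arc *)

Section NumericalRange.
Variables (R : realType) (H : hilbertType R).
Implicit Types (u w v : {linear H -> H}) (x y : H).

Lemma up_comp u u' v v' : unitary_pair u u' -> unitary_pair v v' ->
  unitary_pair (u \o v) (v' \o u').
Proof.
move=> hu hv; split=> [x|x|x y] /=.
- by rewrite (upK hu) (upK hv).
- by rewrite (upKr hv) (upKr hu).
- by rewrite (up_hdot hu) (up_hdot hv).
Qed.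

(** The arc is open, so its end points may be spectral values; this is the situation in the equality
    case. *)
Definition avoids_arc (u : H -> H) (g k : R) :=
  forall s, `|s - g| < k -> ~ spec u (expi s).

Lemma rdotZZ (a b : R) x y :
  rdot (expi a *: x) (expi b *: y) = rdot (expi (a - b) *: x) y.
Proof. by rewrite addrC expiD -scalerA [RHS]rdotZconj expiN conjCK. Qed.

Lemma rdot_expiNl (a : R) x y : rdot (expi (- a) *: x) y = rdot x (expi a *: y).
Proof. by rewrite rdotZconj expiN conjCK. Qed.

Lemma expi_addpi (a : R) : expi (a + pi) = - expi a.
Proof. by rewrite expiD expipi mulrN1. Qed.

(** On the spectrum [|z - e^(ig)|^2 >= 2 - 2 cos k]. The lower bound for the polynomial [X - e^(ig)]
    carries this over to [|u x - e^(ig) x|^2], whose expansion contains the form. *)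
Lemma numerical_range_le u w g k x : unitary_pair u w -> 0 <= k <= pi ->
  avoids_arc u g k -> rdot (u x) (expi g *: x) <= cos k * rnorm x ^+ 2.
Proof.
move=> h /andP[k0 kpi] av.
have c1 : 0 <= 2 - cos k *+ 2 by have := cos_le1 k; rewrite (mulr2n (cos k)); lra.
have hd z : spec u z -> Num.sqrt (2 - cos k *+ 2) <= rnorm ('X - (expi g)%:P).[z].
  move=> sz; have [t /andP[t1 t2] e] := circle_expi_center g (spec_circle h sz).
  rewrite hornerXsubC -ler_sqr ?nnegrE ?sqrtr_ge0 ?rnorm_ge0 // sqr_sqrtr //.
  rewrite e rnorm_expiB lerB // lerMn2r /=; apply: cos_le_center => //.
  rewrite ler_norml t2 andbT (ltW t1) andbT leNgt; apply/negP => hlt.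
  by apply: av hlt _; rewrite -e.
have := polyop_lower_bound h (sqrtr_ge0 _) hd x.
rewrite -ler_sqr ?nnegrE ?mulr_ge0 ?sqrtr_ge0 ?rnorm_ge0 // exprMn sqr_sqrtr //.
rewrite polyopB polyopX polyopC rnorm_sqrB rnormZ rnorm_expi mul1r (up_rnorm _ h).
rewrite (mulr2n (cos k)) (mulr2n (rdot _ _)); lra.
Qed.

(** The operator [D = 2 cos k - e^(-ig) u - e^(ig) w] is positive and equals
    [- e^(-ig) w (u - a) (u - b)], where [a] and [b] are the ends of the arc. Equality forces
    [D x = 0], and [u - a] is injective. The sign of [j] selects the end. *)
Lemma extremal_eigenvector u w g k j x : unitary_pair u w -> 0 <= k <= pi ->
  avoids_arc u g k -> `|j| = k -> ~ spec u (expi (g + j)) ->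
  rdot (u x) (expi g *: x) = cos k * rnorm x ^+ 2 -> u x = expi (g - j) *: x.
Proof.
move=> h kpi av jk nspec eqx.
have h' := unitary_pairC h.
pose a := expi (g + j); pose b := expi (g - j); pose c := expi (- g).
pose P : {poly R[i]} := - c *: (('X - a%:P) * ('X - b%:P)).
pose D : {linear H -> H} := w \o polyop u P.
have cab : c * (a + b) = (cos k *+ 2)%:C.
  rewrite /a /b !expiD expiN -mulrDr mulrA expiNM mul1r -jk cos_norm.
  by apply/eqP; rewrite eq_complex /= subrr mulr2n !eqxx.
have cabM : c * (a * b) = expi g.
  by rewrite /a /b /c -!expiD; congr expi; ring.
have DE y : D y = (cos k *+ 2)%:C *: y - c *: u y - expi g *: w y.
  rewrite /= polyopZ polyopM !polyopB !polyopX !polyopC.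
  rewrite (linB u) (linZ u) (linZ w) !((linB w), (linZ w)).
  rewrite !(upK h) -cab -cabM scaleNr !scalerBr !scalerA mulrDr scalerDl !opprB.
  by rewrite addrACA addrA addrAC mulrA.
have rD y z : rdot (D y) z = cos k *+ 2 * rdot y z
    - rdot (u y) (expi g *: z) - rdot (u z) (expi g *: y).
  rewrite DE !rdotBl rdotZl rdot_expiNl; congr (_ - _).
  rewrite -[X in expi X]opprK rdot_expiNl (up_rdot _ _ h') rdotC linearZ /=.
  by rewrite rdot_expiNl opprK.
have sym y z : rdot (D y) z = rdot y (D z).
  by rewrite [RHS]rdotC !rD (rdotC z y); ring.
have pos y : 0 <= rdot (D y) y.
  have := numerical_range_le y h kpi av.
  by rewrite rD rdotxx (mulr2n (cos k)); lra.
have bD : bounded_by D (`|cos k *+ 2| + 2).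
  move=> y; rewrite DE (le_trans (rnormB _ _)) // (le_trans (lerD (rnormB _ _) (lexx _))) //.
  by rewrite !rnormZ !rnorm_expi rnorm_real (up_rnorm _ h) (up_rnorm _ h'); lra.
have M0 : 0 < `|cos k *+ 2| + 2 by rewrite ltr_wpDl.
have Dx : D x = 0.
  apply/eqP; rewrite -rnorm_eq0 -sqrf_eq0 eq_le sqr_ge0 andbT.
  rewrite (le_trans (positive_bound M0 bD sym pos x)) //.
  by rewrite rD rdotxx eqx (mulr2n (cos k)); lra.
pose y := u x - b *: x.
have uy : a *: y - u y = 0.
  have := Dx; rewrite /= -[in X in X -> _](linear0 w) => /(can_inj (upKr h))/eqP.
  rewrite polyopZ scaler_eq0 oppr_eq0 -rnorm_eq0 rnorm_expi oner_eq0 /=.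
  rewrite polyopM !polyopB !polyopX !polyopC.
  by rewrite -oppr_eq0 opprB => /eqP.
have /not_specP[[d d0 hd] _] := nspec.
apply/eqP; rewrite -subr_eq0 -/y -rnorm_eq0 eq_le rnorm_ge0 andbT -(ler_pM2l d0) mulr0.
by rewrite (le_trans (hd y)) // uy rnorm0.
Qed.

(** The shift by [pi] turns the lower bound wanted for the form of [v] into an upper bound, the kind
    that [numerical_range_le] provides. *)
Lemma comp_rdot v w (t g : R) x : unitary_pair v w ->
  rdot (expi t *: x) (expi g *: v x) = - rdot (v x) (expi (t - g + pi) *: x).
Proof.
move=> h; rewrite rdotZZ expi_addpi scaleNr rdotNr opprK.
by rewrite rdotC.
Qed.

(* With [y = v x] one has
   [Re <e^(it) x - u y, e^(ig) y> = Re <v x, e^(i(t-g)) x> - Re <u y, e^(ig) y>], where the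
   first term is at least [cos k' |x|^2] and the second at most [cos k |x|^2]. *)
Lemma comp_not_spec u u' v v' (t g k k' : R) :
  unitary_pair u u' -> unitary_pair v v' -> 0 <= k' -> k' < k -> k <= pi ->
  avoids_arc u g k -> avoids_arc v (t - g + pi) (pi - k') ->
  ~ spec (u \o v) (expi t).
Proof.
move=> hu hv k'0 k'k kpi au av.
move/(spec_unitaryP _ (up_comp hu hv)) => sp.
have c0 : 0 < cos k' - cos k.
  by rewrite subr_gt0 ltr_cos ?in_itv /=; rewrite ?k'0 ?kpi //; apply/andP; split; lra.
have [x /=] := sp _ c0; apply/negP; rewrite -leNgt rnormBC.
have [->|x0] := eqVneq x 0; first by rewrite rnorm0 mulr0 rnorm_ge0.
have {}x0 : 0 < rnorm x by rewrite rnorm_gt0.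
have k0 : 0 <= k <= pi by apply/andP; split; lra.
have k'0' : 0 <= pi - k' <= pi by apply/andP; split; lra.
have h1 := numerical_range_le (v x) hu k0 au.
have h2 := numerical_range_le x hv k'0' av.
have h3 := rdot_le (expi t *: x - u (v x)) (expi g *: v x).
rewrite rdotBl (comp_rdot _ _ _ hv) rnormZ rnorm_expi mul1r (up_rnorm _ hv) in h3.
rewrite (up_rnorm _ hv) in h1.
have e : cos (pi - k') = - cos k' by rewrite addrC cosDpi cosN.
rewrite e in h2.
by rewrite -(ler_pM2r x0); move: h1 h2 h3; rewrite !expr2; nra.
Qed.

(** The number [Re <e^(it) x, e^(ig) v x>] is at most [cos k |x|^2] because of [u] and at least that
    because of [v], so both estimates are equalities. *)
Lemma comp_eigenvector u u' v v' (t g k : R) x :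
  unitary_pair u u' -> unitary_pair v v' -> 0 <= k <= pi ->
  avoids_arc u g k -> avoids_arc v (t - g + pi) (pi - k) ->
  u (v x) = expi t *: x ->
  rdot (u (v x)) (expi g *: v x) = cos k * rnorm (v x) ^+ 2 /\
  rdot (v x) (expi (t - g + pi) *: x) = cos (pi - k) * rnorm x ^+ 2.
Proof.
move=> hu hv kpi au av e.
have k'0' : 0 <= pi - k <= pi by case/andP: kpi => *; apply/andP; split; lra.
have h1 := numerical_range_le (v x) hu kpi au.
have h2 := numerical_range_le x hv k'0' av.
have e' : cos (pi - k) = - cos k by rewrite addrC cosDpi cosN.
move: h1; rewrite e (comp_rdot _ _ _ hv) (up_rnorm _ hv); move: h2; rewrite e'.
by move=> h2 h1; split; lra.
Qed.

End NumericalRange.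

(** * Double sums with coefficients *)

Section DoubleSums.
Variables (K : nzRingType) (V : lmodType K).
Implicit Types (c : nat -> nat -> K) (E : nat -> nat -> V).

(** Common shape of the scalar and operator values of a star-polynomial; [cut] pads the coefficients
    by zero, so that sums of different sizes can be added. *)
Definition dsum n c E : V := \sum_(j < n) \sum_(k < n) c j k *: E j k.

Definition cut n c j k : K := if (j < n)%N && (k < n)%N then c j k else 0.

Lemma dsum_cut n m c E : (n <= m)%N -> dsum n c E = dsum m (cut n c) E.
Proof.
move=> nm; rewrite /dsum (big_ord_widen m (fun j => \sum_(k < n) c j k *: E j k) nm) big_mkcond.
apply: eq_bigr => j _; rewrite /cut; case: ltnP => jn /=; last first.
  by rewrite big1 // => k _; rewrite scale0r.
rewrite (big_ord_widen m (fun k => c j k *: E j k) nm) big_mkcond.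
by apply: eq_bigr => k _; case: ltnP => // _; rewrite scale0r.
Qed.

Lemma dsumD n c d E : dsum n c E + dsum n d E = dsum n (fun j k => c j k + d j k) E.
Proof.
rewrite /dsum -big_split; apply: eq_bigr => j _; rewrite -big_split.
by apply: eq_bigr => k _; rewrite scalerDl.
Qed.

Lemma dsumZ n a c E : a *: dsum n c E = dsum n (fun j k => a * c j k) E.
Proof.
rewrite /dsum scaler_sumr; apply: eq_bigr => j _; rewrite scaler_sumr.
by apply: eq_bigr => k _; rewrite scalerA.
Qed.

Lemma dsum_shiftl n c E : dsum n c (fun j k => E j.+1 k) =
  dsum n.+1 (fun j k => if j is i.+1 then cut n c i k else 0) E.
Proof.
rewrite /dsum [RHS]big_ord_recl [X in X + _]big1 ?add0r; last first.
  by move=> k _; rewrite scale0r.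
apply: eq_bigr => j _; rewrite big_ord_recr /= /cut ltnn andbF scale0r addr0.
by apply: eq_bigr => k _; rewrite !ltn_ord.
Qed.

Lemma dsum_shiftr n c E : dsum n c (fun j k => E j k.+1) =
  dsum n.+1 (fun j k => if k is i.+1 then cut n c j i else 0) E.
Proof.
rewrite /dsum [RHS]big_ord_recr /= [X in _ + X]big1 ?addr0; last first.
  by move=> [[|k] hk] _; rewrite /= ?scale0r // /cut ltnn scale0r.
apply: eq_bigr => j _; rewrite [RHS]big_ord_recl /= scale0r add0r.
by apply: eq_bigr => k _; rewrite /cut !ltn_ord.
Qed.

End DoubleSums.

(** * Star-polynomials in a unitary *)

Section StarPolynomials.
Variables (R : realType) (H : hilbertType R).
Variables (u w : {linear H -> H}).
Hypothesis h : unitary_pair u w.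

Lemma adjointE : adjoint u = w.
Proof.
have bw : bounded_op w.
  by apply/bounded_opE; exists 1 => //; exact: up_bounded (unitary_pairC h).
rewrite /adjoint; apply: xget_unique; first by split=> // x y; rewrite (up_hdot h).
move=> S [_ hS]; apply/funext => y; apply: hdot_inj => x.
by rewrite -hS (up_hdot h).
Qed.

(* [F] is the operator that results from evaluating the *-polynomial [f] at [u]. *)
Definition starrep (f : R[i] -> R[i]) (F : H -> H) := exists n c,
  (forall z, f z = starpoly n c z) /\ (forall x, F x = starpoly_op n c u x).

Lemma starpolyE n c (z : R[i]) :
  starpoly n c z = @dsum _ R[i]^o n c (fun j k => z ^+ j * Num.conj z ^+ k).
Proof. by apply: eq_bigr => j _; apply: eq_bigr => k _; rewrite -mulrA. Qed.

Lemma starpoly_opE n c x :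
  starpoly_op n c u x = dsum n c (fun j k => iter j u (iter k w x)).
Proof. by rewrite /starpoly_op adjointE. Qed.

Lemma starrep0 : starrep (fun=> 0) (fun=> 0).
Proof.
by exists 0%N, (fun _ _ => 0); split=> x; rewrite /starpoly /starpoly_op big_ord0.
Qed.

Lemma starrep1 : starrep (fun=> 1) id.
Proof.
exists 1%N, (fun _ _ => 1); split=> x.
  by rewrite /starpoly !big_ord1 !expr0 !mulr1.
by rewrite /starpoly_op !big_ord1 scale1r.
Qed.

Lemma starrepD f F g G : starrep f F -> starrep g G ->
  starrep (fun z => f z + g z) (fun x => F x + G x).
Proof.
move=> [n [c [hf hF]]] [m [d [hg hG]]].
exists (maxn n m), (fun j k => cut n c j k + cut m d j k); split=> x.
  rewrite hf hg !starpolyE -dsumD; congr (_ + _); apply: dsum_cut.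
    exact: leq_maxl.
  exact: leq_maxr.
rewrite hF hG !starpoly_opE -dsumD; congr (_ + _); apply: dsum_cut.
  exact: leq_maxl.
exact: leq_maxr.
Qed.

Lemma starrepZ a f F : starrep f F -> starrep (fun z => a * f z) (fun x => a *: F x).
Proof.
move=> [n [c [hf hF]]]; exists n, (fun j k => a * c j k); split=> x.
  by rewrite hf !starpolyE -dsumZ.
by rewrite hF !starpoly_opE -dsumZ.
Qed.

Lemma starrepB f F g G : starrep f F -> starrep g G ->
  starrep (fun z => f z - g z) (fun x => F x - G x).
Proof.
move=> hf /(starrepZ (-1)) hg; have := starrepD hf hg.
congr starrep; apply/funext => x; first by rewrite mulN1r.
by rewrite scaleN1r.
Qed.

Lemma starrepMz f F : starrep f F -> starrep (fun z => z * f z) (fun x => u (F x)).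
Proof.
move=> [n [c [hf hF]]].
exists n.+1, (fun j k => if j is i.+1 then cut n c i k else 0); split=> x.
  rewrite hf !starpolyE -dsum_shiftl /dsum mulr_sumr; apply: eq_bigr => j _.
  rewrite mulr_sumr; apply: eq_bigr => k _.
  by rewrite /GRing.scale /= exprS -mulrA mulrCA.
rewrite hF !starpoly_opE -dsum_shiftl /dsum linear_sum; apply: eq_bigr => j _.
by rewrite linear_sum; apply: eq_bigr => k _; rewrite linearZ.
Qed.

Lemma starrepMconj f F : starrep f F ->
  starrep (fun z => Num.conj z * f z) (fun x => F (w x)).
Proof.
move=> [n [c [hf hF]]].
exists n.+1, (fun j k => if k is i.+1 then cut n c j i else 0); split=> x.
  rewrite hf !starpolyE -dsum_shiftr /dsum mulr_sumr; apply: eq_bigr => j _.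
  rewrite mulr_sumr; apply: eq_bigr => k _.
  by rewrite /GRing.scale /= exprS mulrCA; congr (_ * _); rewrite mulrCA.
rewrite hF !starpoly_opE -dsum_shiftr /dsum; apply: eq_bigr => j _.
by apply: eq_bigr => k _; rewrite iterSr.
Qed.

(** The adjoint of [u] is its inverse and the conjugate of [z] on the circle is [z^-1], so
    multiplication by an [m]-th power clears the negative exponents and leaves a polynomial. *)
Lemma starpoly_polyop n c : exists m Q,
  (forall x, polyop u Q x = iter m u (starpoly_op n c u x)) /\
  (forall z, rnorm z = 1 -> Q.[z] = z ^+ m * starpoly n c z).
Proof.
exists n, (\sum_(j < n) \sum_(k < n) c j k *: 'X^(n - k + j)); split=> [x|z z1].
  rewrite starpoly_opE polyop_sum /dsum -polyopXn linear_sum; apply: eq_bigr => j _.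
  rewrite polyop_sum linear_sum; apply: eq_bigr => k _.
  rewrite polyopZ linearZ /= !polyopXn -iterD addnC iterD.
  rewrite (up_iter_sub _ h) ?(ltnW (ltn_ord k)) //.
  by rewrite -!iterD addnC.
rewrite horner_sum mulr_sumr; apply: eq_bigr => j _.
rewrite horner_sum mulr_sumr; apply: eq_bigr => k _.
rewrite hornerZ hornerXn exprD.
have -> : z ^+ n = z ^+ (n - k) * z ^+ k by rewrite -exprD subnK // ltnW.
rewrite -[LHS]mulr1 -(expr1n _ k) -(conj_circle z1) exprMn.
by ring.
Qed.

End StarPolynomials.

(** * Existence of the logarithm as a norm-convergent series *)

Section LogExistence.
Variables (R : realType) (H : hilbertType R).
Variables (u w : {linear H -> H}).
Hypothesis h : unitary_pair u w.

Lemma principal_argE t : - pi < t <= pi -> principal_arg (expi t) = t :> R.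
Proof.
move=> /andP[t1 t2]; have n1 : `|expi t| = 1 by rewrite rnormE rnorm_expi.
apply: xget_unique => [|s] /=; first by rewrite t1 t2 n1 mul1r.
move=> [/andP[s1 s2]]; rewrite n1 mul1r => /expi_inj -> //.
by rewrite mulr2n ltr_norml; apply/andP; split; lra.
Qed.

Lemma principal_logE t : - pi < t <= pi -> principal_log (expi t) = 'i%C * t%:C :> R[i].
Proof.
move=> ht; rewrite /principal_log principal_argE // rnormE rnorm_expi ln1.
by apply/eqP; rewrite eq_complex /=; apply/andP; split; apply/eqP; ring.
Qed.

(* For [u = e^(it)], [T] is [sin^2 (t/2)] and [Y] is [i sin t]. *)
Variables T Y : {linear H -> H}.
Hypothesis TE : forall x, T x = - 4%:R^-1 *: (u x - x - x + w x).
Hypothesis YE : forall x, Y x = 2%:R^-1 *: (u x - w x).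
Let s (z : R[i]) := - 4%:R^-1 * (z - 1 - 1 + Num.conj z).

Let T_w x : T (w x) = w (T x).
Proof.
rewrite !TE (upKr h) (linZ w) (linD w) !(linB w) (upK h).
by congr (_ *: _); rewrite addrAC.
Qed.

Let iterT_w n x : iter n T (w x) = w (iter n T x).
Proof. by elim: n => // n IH; rewrite !iterS IH T_w. Qed.

Let starrepT f F : starrep u f F -> (forall x, F (w x) = w (F x)) ->
  starrep u (fun z => s z * f z) (fun x => T (F x)).
Proof.
move=> hf hc; have := starrepZ h (- 4%:R^-1) (starrepD h (starrepB h (starrepB h
  (starrepMz h hf) hf) hf) (starrepMconj h hf)).
congr starrep; apply/funext => x; first by rewrite /s -mulrA !(mulrDl, mulNr) !mul1r.
by rewrite TE hc.
Qed.

Let starrep_iterT n : starrep u (fun z => s z ^+ n) (iter n T).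
Proof.
elim: n => [|n IH]; first exact: starrep1.
have := starrepT IH; rewrite (_ : (fun z => _) = (fun z => s z ^+ n.+1)); last first.
  by apply/funext => z; rewrite exprS.
by apply=> x; rewrite iterT_w.
Qed.

(** Truncated series for [log u]; [partialf] is the matching scalar function, with value
    [i sin t sum_(k < n) a_k sin^(2k) (t/2)] at [e^(it)]. *)
Let partial n (x : H) := \sum_(k < n) (asin_coeff R k)%:C *: Y (iter k T x).

Let partialf n (z : R[i]) := \sum_(k < n)
  (asin_coeff R k)%:C * (2%:R^-1 * ((z - Num.conj z) * s z ^+ k)).

Let starrep_partial n : starrep u (partialf n) (partial n).
Proof.
elim: n => [|n IH].
  have := starrep0 u; congr starrep; apply/funext => x; rewrite /partialf /partial big_ord0 //.
have := starrepD h IH (starrepZ h (asin_coeff R n)%:C (starrepZ h 2%:R^-1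
  (starrepB h (starrepMz h (starrep_iterT n)) (starrepMconj h (starrep_iterT n))))).
congr starrep; apply/funext => x; rewrite /partialf /partial big_ord_recr /=.
  by rewrite mulrBl.
by rewrite YE iterT_w.
Qed.

Let s_expi t : s (expi t) = ((1 - cos t) / 2)%:C.
Proof.
rewrite /s; have -> : (- 4%:R^-1 : R[i]) = (- 4^-1 : R)%:C.
  by rewrite rmorphN fmorphV rmorph_nat.
by apply/eqP; rewrite eq_complex /=; apply/andP; split; apply/eqP; field.
Qed.

Let partialf_expi n t : partialf n (expi t) =
  'i%C * (sin t * (\sum_(k < n) asin_coeff R k * ((1 - cos t) / 2) ^+ k))%:C.
Proof.
rewrite /partialf rmorphM /= mulrA rmorph_sum /= mulr_sumr; apply: eq_bigr => k _.
rewrite rmorphM rmorphXn /= s_expi [RHS]mulrCA; congr (_ * _).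
rewrite mulrA; congr (_ * _).
have -> : (2%:R^-1 : R[i]) = (2^-1 : R)%:C by rewrite fmorphV rmorph_nat.
by apply/eqP; rewrite eq_complex /=; apply/andP; split; apply/eqP; field.
Qed.

Variables (d : R) (d01 : 0 < d <= 1).
Hypothesis hd : forall x, d * rnorm x <= rnorm (u x + x).

(** By the parallelogram identity, [|u x + x| >= d |x|] gives [|u x - x|^2 <= 4 rho |x|^2]. As
    [T = - w (u - 1)^2 / 4], [rho] bounds the norm of [T]. *)
Let rho := 1 - d ^+ 2 / 4.

Let rho01 : 0 <= rho < 1.
Proof. by case/andP: d01 => d0 d1; rewrite /rho; apply/andP; split; nra. Qed.

Let uB_bound x : rnorm (u x - x) ^+ 2 <= 4 * rho * rnorm x ^+ 2.
Proof.
have /andP[d0 _] := d01.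
have : (d * rnorm x) ^+ 2 <= rnorm (u x + x) ^+ 2.
  by rewrite ler_sqr ?nnegrE ?mulr_ge0 ?rnorm_ge0 // ltW.
rewrite rnorm_sqrB rnorm_sqrD (up_rnorm _ h) (mulr2n (rdot _ _)) exprMn /rho; lra.
Qed.

Let T_bound x : rnorm (T x) <= rho * rnorm x.
Proof.
have /andP[r0 _] := rho01.
have -> : T x = - 4%:R^-1 *: w (u (u x - x) - (u x - x)).
  rewrite TE (linB w) (linB u) !(linB w) !(upK h) opprB; congr (_ *: _).
  by rewrite [w x - x]addrC addrA.
rewrite rnormZ rnormN (up_rnorm _ (unitary_pairC h)).
have -> : rnorm (4%:R^-1 : R[i]) = 4^-1.
  by rewrite -(rmorph_nat (real_complex R)) -fmorphV rnorm_real ger0_norm.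
rewrite mulrC ler_pdivrMr // -ler_sqr ?nnegrE ?mulr_ge0 ?rnorm_ge0 //.
rewrite (le_trans (uB_bound _)) //.
have r4 : 0 <= 4 * rho by rewrite mulr_ge0.
rewrite (le_trans (ler_wpM2l r4 (uB_bound x))) // le_eqVlt.
by apply/orP; left; apply/eqP; ring.
Qed.

Let Y_bound x : rnorm (Y x) <= rnorm x.
Proof.
rewrite YE rnormZ.
have -> : rnorm (2%:R^-1 : R[i]) = 2^-1.
  by rewrite -(rmorph_nat (real_complex R)) -fmorphV rnorm_real ger0_norm.
rewrite mulrC ler_pdivrMr // (le_trans (rnormB _ _)) //.
by rewrite (up_rnorm _ h) (up_rnorm _ (unitary_pairC h)); lra.
Qed.

Let iterT_bound k x : rnorm (iter k T x) <= rho ^+ k * rnorm x.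
Proof.
have /andP[r0 _] := rho01.
elim: k => [|k IH]; first by rewrite mul1r.
by rewrite iterS (le_trans (T_bound _)) // exprS -mulrA ler_wpM2l.
Qed.

Let partial_linear n : linear (partial n).
Proof.
move=> a x y; rewrite /partial scaler_sumr -big_split; apply: eq_bigr => k _ /=.
by rewrite iter_linear (linearP Y) scalerDr !scalerA [_ * a]mulrC.
Qed.

Let partial_cvg x : exists l, forall n,
  rnorm (partial n x - l) <= rnorm x / (1 - rho) * rho ^+ n.
Proof.
apply: geometric_cvg => // n.
rewrite /partial big_ord_recr /= addrAC subrr add0r rnormZ rnorm_real.
have /andP[a0 a1] := asin_coeff_bound R n.
rewrite ger0_norm // -[leRHS]mul1r ler_pM ?rnorm_ge0 //.
by rewrite (le_trans (Y_bound _)) // mulrC iterT_bound.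
Qed.

Lemma log_series_cfc : exists S, is_cfc u (@principal_log R) S.
Proof.
have /andP[r0 r1] := rho01; have /andP[d0 _] := d01.
have [S hS] := choice partial_cvg.
(* Linearity passes to the limit: the defect is at most a constant times [rho^N] for every [N]. *)
have linS : linear S.
  move=> a x y; apply/eqP; rewrite -subr_eq0 -rnorm_eq0 eq_le rnorm_ge0 andbT.
  apply/ler_addgt0Pr => e e0; rewrite add0r.
  pose C (z : H) := rnorm z / (1 - rho).
  have [N hN] := geometric_small (C (a *: x + y) + (rnorm a * C x + C y)) rho01 e0.
  apply: le_trans (ltW (hN N (leqnn _))).
  have -> : S (a *: x + y) - (a *: S x + S y) =
      (a *: (partial N x - S x) + (partial N y - S y))
      - (partial N (a *: x + y) - S (a *: x + y)).
    rewrite partial_linear scalerBr addrACA -opprD opprB.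
    by rewrite [RHS]addrC subrKA.
  rewrite (le_trans (rnormB _ _)) // addrC mulrDl lerD ?hS //.
  rewrite (le_trans (rnormD _ _)) // mulrDl lerD ?hS // rnormZ -mulrA.
  by rewrite ler_wpM2l ?rnorm_ge0 ?hS.
exists S; split.
  have [S' eS] := linear_pack linS; rewrite -eS; apply/bounded_opE.
  exists (1 - rho)^-1; first by rewrite invr_gt0 subr_gt0.
  move=> x; have := hS x 0%N; rewrite /partial big_ord0 sub0r rnormN expr0 mulr1.
  by rewrite eS mulrC.
move=> e e0.
have ee : e = (complex.Re e)%:C.
  by move: e0; rewrite ltcE /=; case: (e) => a b /= /andP[/eqP -> _].
have e0' : 0 < complex.Re e by rewrite -ltcR -ee.
have [N1 hN1] := geometric_small (1 - rho)^-1 rho01 e0'.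
have [N2 hN2] := arg_approx rho01 e0'.
pose n := maxn N1 N2; have [m [c [hf hF]]] := starrep_partial n.
exists m, c; split=> [z sz|x]; last first.
  rewrite -hF !rnormE ee -rmorphM lecR rnormBC (le_trans (hS _ _)) //.
  rewrite mulrC mulrA mulrAC ler_wpM2r ?rnorm_ge0 // mulrC.
  by rewrite ltW // hN1 // leq_maxl.
have [t ht et] := circle_expi (spec_circle h sz).
rewrite -hf et principal_logE // partialf_expi -mulrBr -rmorphB rnormE rnormM rnorm_i mul1r.
rewrite rnorm_real ee lecR distrC; apply: hN2; first exact: leq_maxr.
  by case/andP: ht => h1 h2; rewrite ler_norml h2 (ltW h1).
(* The lower bound of [u + 1] is tested on approximate eigenvectors for [z]; since
   [|e^(it) + 1|^2 = 2 + 2 cos t], it gives [(1 - cos t) / 2 <= rho]. *)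
have dz : d <= rnorm (z + 1).
  apply/ler_addgt0Pr => e1 e10; have /(spec_unitaryP _ h) /(_ _ e10) [x hx] := sz.
  have x0 : 0 < rnorm x.
    rewrite lt_neqAle rnorm_ge0 andbT eq_sym; apply/eqP => x0; move: hx.
    by rewrite x0 mulr0 ltNge rnorm_ge0.
  rewrite -(ler_pM2r x0) (le_trans (hd x)) // mulrDl -rnormZ.
  have -> : u x + x = (z + 1) *: x + (u x - z *: x).
    by rewrite scalerDl scale1r [RHS]addrC subrKA.
  by rewrite (le_trans (rnormD _ _)) // lerD2l ltW.
have : d ^+ 2 <= rnorm (z + 1) ^+ 2 by rewrite ler_sqr ?nnegrE ?rnorm_ge0 // ltW.
rewrite et rnorm_sqr /= addr0 /rho; have := cos2Dsin2 t; nra.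
Qed.

End LogExistence.

(** [T] and [Y] are written as [w] after a polynomial in [u], which makes them linear maps by
    construction. *)
Lemma log_exists (R : realType) (H : hilbertType R) (u w : {linear H -> H}) :
  unitary_pair u w -> ~ spec u (-1) -> exists S, is_cfc u (@principal_log R) S.
Proof.
move=> h /not_specP[[d d0 hd] _].
apply: (@log_series_cfc _ _ _ _ h (w \o polyop u (- 4%:R^-1 *: (('X - 1) * ('X - 1))))
  (w \o polyop u (2%:R^-1 *: ('X * 'X - 1))) _ _ (Num.min d 1)) => [x|x||x].
- rewrite /= polyopZ polyopM !polyopB !polyopX !polyopC !scale1r (linZ w) (linB u) !(linB w).
  by rewrite !(upK h) opprB [w x - x]addrC addrA.
- by rewrite /= polyopZ polyopB polyopM !polyopX !polyopC !scale1r (linZ w) (linB w) (upK h).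
- by rewrite lt_min d0 ltr01 ge_min lexx orbT.
- have -> : u x + x = - (-1 *: x - u x) by rewrite scaleN1r opprB opprK.
  by rewrite rnormN (le_trans _ (hd x)) // ler_wpM2r ?rnorm_ge0 // ge_min lexx.
Qed.

Lemma closed_has_max (R : realType) (A : set R) : A !=set0 -> has_ubound A ->
  (forall t, (forall d, 0 < d -> exists2 s, A s & `|s - t| < d) -> A t) ->
  exists2 m, A m & forall s, A s -> s <= m.
Proof.
move=> A0 bA clA; have sA : has_sup A by [].
exists (sup A); last by move=> s As; exact: ub_le_sup.
apply: clA => d d0; have [s As hs] := sup_adherent d0 sA.
exists s => //; rewrite distrC ger0_norm ?subr_ge0 ?ub_le_sup //; lra.
Qed.

(** * The spectrum of the logarithm *)

Section LogSpectrum.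
Variables (R : realType) (H : hilbertType R).
Variables (u w : {linear H -> H}).
Hypothesis h : unitary_pair u w.

(** After multiplication by the isometry [u^m] the difference is a polynomial in [u] vanishing at
    [z], so [u - z] can be factored out. Approximate eigenvectors of [u] thus serve for its
    star-polynomials. *)
Lemma starpoly_op_eigen n c z : rnorm z = 1 -> exists2 M, 0 < M &
  forall x, rnorm (starpoly_op n c u x - starpoly n c z *: x) <= M * rnorm (u x - z *: x).
Proof.
move=> z1; have [m [Q [Qop Qz]]] := starpoly_polyop h n c.
pose P := Q - starpoly n c z *: 'X^m.
have : root P z by rewrite /root /P hornerD hornerN hornerZ hornerXn Qz // mulrC subrr.
move=> /factor_theorem[P' eP].
have [M M0 hM] := polyop_bounded P' (up_bounded h).
exists M => // x; have := hM (u x - z *: x); apply: le_trans.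
rewrite -(polyopX u x) -(polyopC u z x) -polyopB -polyopM -eP /P polyopB polyopZ Qop polyopXn.
rewrite -(up_rnorm_iter m _ h) -!(polyopXn u m) linearB linearZ //.
Qed.

Lemma spec_closed z : (forall e : R, 0 < e -> exists2 z', spec u z' & rnorm (z' - z) < e) ->
  spec u z.
Proof.
move=> hz; apply/(spec_unitaryP z h) => e e0.
have e2 : 0 < e / 2 by rewrite divr_gt0.
have [z' /(spec_unitaryP _ h) /(_ _ e2) [x hx] hz'] := hz _ e2.
exists x; rewrite (le_lt_trans (rnorm_triangle (z' *: x) _ _)) // -scalerBl rnormZ.
by have := ler_wpM2r (rnorm_ge0 x) (ltW hz'); lra.
Qed.

Lemma spec_arg_max : (exists x : H, x != 0) -> ~ spec u (-1) ->
  exists t : R, [/\ - pi < t < pi, spec u (expi t) &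
    forall s, - pi < s <= pi -> spec u (expi s) -> s <= t].
Proof.
move=> /(spec_nonempty h)[z sz] u1.
have [t0 /andP[t01 t02] et0] := circle_expi (spec_circle h sz).
(* The value [-pi] is allowed so that [A] is closed; neither end is attained, because [-1] is not in
   the spectrum. *)
pose A := [set t : R | - pi <= t <= pi /\ spec u (expi t)].
have A0 : A !=set0 by exists t0; rewrite /A /= (ltW t01) t02 -et0.
have bA : has_ubound A by exists pi => s [/andP[]].
have [|m [/andP[m1 m2] sm] hm] := closed_has_max A0 bA.
  move=> t ht; split.
    apply/andP; split.
      rewrite leNgt; apply/negP => tpi; have [|s [/andP[s1 _] _]] := ht (- pi - t).
        by rewrite subr_gt0.
      by rewrite ltr_norml => /andP[_]; lra.
    rewrite leNgt; apply/negP => tpi; have [|s [/andP[_ s1] _]] := ht (t - pi).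
      by rewrite subr_gt0.
    by rewrite ltr_norml => /andP[]; lra.
  apply: spec_closed => e e0; have [d d0 hd] := expi_continuous e0.
  by have [s [_ ss] st] := ht d d0; exists (expi s) => //; exact: hd.
exists m; split=> //; last by move=> s /andP[s1 s2] ss; apply: hm; rewrite /A /= (ltW s1).
rewrite !lt_neqAle m1 m2 !andbT; apply/andP; split; apply/eqP => e; apply: u1.
  by move: sm; rewrite -e expiN expipi rmorphN rmorph1.
by move: sm; rewrite e expipi.
Qed.

Variable S : H -> H.
Hypothesis hS : is_cfc u (@principal_log R) S.

Let L x := - 'i%C *: S x.

Let iNi : - ('i%C : R[i]) * 'i%C = 1.
Proof. by rewrite mulNr -expr2 sqr_i opprK. Qed.

Let L_diff z x : z *: x - L x = - 'i%C *: (('i%C * z) *: x - S x).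
Proof. by rewrite scalerBr scalerA mulrA iNi mul1r. Qed.

Let linS : linear S. Proof. by case: hS => [[]]. Qed.

Let linL : linear L.
Proof. by move=> a x y; rewrite /L linS scalerDr !scalerA mulrC. Qed.

(** An approximate eigenvector of [u] for [e^(it)] is one of [L] for [t]: three errors of size
    [d / 4] stay below a supposed lower bound [d] of [t - L]. *)
Lemma log_spec_arg t : - pi < t <= pi -> spec u (expi t) -> spec L t%:C.
Proof.
move=> ht st; apply: contrapT; have [L' eL] := linear_pack linL.
rewrite -eL => /not_specP[[d d0 hd] _].
have e0 : 0 < (d / 4)%:C by rewrite ltcR divr_gt0.
have [n [c [hz hx]]] := hS.2 _ e0.
have [M M0 hM] := starpoly_op_eigen n c (rnorm_expi t).
have e1 : 0 < d / 4 / M by rewrite !divr_gt0.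
have /(spec_unitaryP _ h) /(_ _ e1) [x ux] := st.
have := hd x; rewrite eL L_diff rnormZ rnormN rnorm_i mul1r.
apply/negP; rewrite -ltNge.
have h1 : rnorm ('i%C * t%:C - starpoly n c (expi t)) <= d / 4.
  by have := hz _ st; rewrite principal_logE // rnormE lecR.
have h2 : rnorm (S x - starpoly_op n c u x) <= d / 4 * rnorm x.
  by have := hx x; rewrite !rnormE -rmorphM lecR.
have h3 := ler_wpM2r (rnorm_ge0 x) h1; rewrite -rnormZ scalerBl in h3.
have h4 : M * rnorm (u x - expi t *: x) < d / 4 * rnorm x.
  by rewrite -ltr_pdivlMl // mulrA [M^-1 * _]mulrC.
have h5 := hM x.
have h6 := rnorm_triangle (starpoly n c (expi t) *: x) (('i%C * t%:C) *: x) (S x).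
have h7 := rnorm_triangle (starpoly_op n c u x) (S x) (starpoly n c (expi t) *: x).
rewrite [rnorm (starpoly n c (expi t) *: x - S x)]rnormBC in h6.
have x0 : 0 <= d / 4 * rnorm x by rewrite mulr_ge0 ?rnorm_ge0 // ltW // divr_gt0.
lra.
Qed.

(** For [z] at distance [d] from the segment, [S - i z] is within [d / 4] of a star-polynomial in
    [u] whose values on the spectrum are at least [3 d / 4] in modulus; invertibility survives this
    perturbation. *)
Lemma log_spec_segment a b : (forall t, - pi < t <= pi -> spec u (expi t) -> a <= t <= b) ->
  forall z, spec L z -> exists2 t, a <= t <= b & z = t%:C.
Proof.
move=> hab z; apply: contraPP => hz.
have [d d0 hd] : exists2 d, 0 < d & forall t, a <= t <= b -> d <= rnorm (z - t%:C).
  case: z hz => x y hz; have [y0|y0] := eqVneq y 0.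
    have re t : rnorm (x +i* y - t%:C) = `|x - t|.
      by rewrite y0 -rnorm_real rmorphB.
    have [xa|xa] := ltP x a.
      exists (a - x); first by rewrite subr_gt0.
      by move=> t /andP[at_ _]; rewrite re distrC (le_trans _ (ler_norm _)) // lerB.
    have [xb|xb] := ltP b x.
      exists (x - b); first by rewrite subr_gt0.
      by move=> t /andP[_ tb]; rewrite re (le_trans _ (ler_norm _)) // lerB.
    by exfalso; apply: hz; exists x; rewrite ?xa ?xb // y0.
  exists `|y|; first by rewrite normr_gt0.
  move=> t _; rewrite -ler_sqr ?nnegrE ?rnorm_ge0 // rnorm_sqr /= subr0 real_normK ?num_real //.
  by rewrite lerDr sqr_ge0.
have [L' eL] := linear_pack linL; rewrite -/L -eL.
have d4 : 0 < d / 4 by rewrite divr_gt0.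
have e0 : 0 < (d / 4)%:C by rewrite ltcR.
have [n [c [hc hx]]] := hS.2 _ e0.
have [m [Q [Qop Qz]]] := starpoly_polyop h n c.
pose P := Q - ('i%C * z) *: 'X^m.
have lowP : forall x, (d * 3 / 4) * rnorm x <= rnorm (polyop u P x).
  apply: (polyop_lower_bound h) => [|l sl]; first by lra.
  have l1 := spec_circle h sl.
  rewrite /P hornerD hornerN hornerZ hornerXn Qz // [_ * l ^+ m]mulrC -mulrBr.
  rewrite rnormM rnormX l1 expr1n mul1r.
  have [t ht et] := circle_expi l1; rewrite {}et {l1} in sl *.
  have h1 := hc _ sl; rewrite principal_logE // rnormE lecR in h1.
  have h2 := hd _ (hab _ ht sl).
  rewrite -[rnorm (z - _)]mul1r -(rnorm_i R) -rnormM mulrBr in h2.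
  have := rnorm_triangle (starpoly n c (expi t)) ('i%C * z) ('i%C * t%:C).
  rewrite (rnormBC (starpoly n c (expi t)) ('i%C * t%:C)).
  by rewrite (rnormBC ('i%C * z) (starpoly _ _ _)); lra.
pose C0 x := iter m u (S x - ('i%C * z) *: x).
have linC : linear C0.
  move=> k x y; rewrite /C0 -iter_linear; congr iter.
  by rewrite linS scalerDr opprD addrACA scalerBr !scalerA (mulrC k).
have [C eC] := linear_pack linC.
have CE x : C x = iter m u (S x - ('i%C * z) *: x) by rewrite eC.
have CP x : rnorm (C x - polyop u P x) <= d / 4 * rnorm x.
  have -> : C x - polyop u P x = iter m u (S x - starpoly_op n c u x).
    rewrite CE /P polyopB polyopZ Qop polyopXn -!(polyopXn u m).
    rewrite !(linB (polyop u _)) (linZ (polyop u _)).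
    by rewrite opprB addrA subrK.
  rewrite (up_rnorm_iter _ _ h).
  by have := hx x; rewrite !rnormE -rmorphM lecR.
have [M1 M10 hM1] := polyop_bounded P (up_bounded h).
have [M2 M20 hM2] := polyop_bounded (map_poly Num.conj P) (up_bounded (unitary_pairC h)).
have bC : bounded_by C (d / 4 + M1).
  move=> x; rewrite mulrDl -(subrK (polyop u P x) (C x)) (le_trans (rnormD _ _)) //.
  by rewrite lerD ?CP ?hM1.
have lowC x : d / 2 * rnorm x <= rnorm (C x).
  have := rnormD (C x) (polyop u P x - C x); rewrite addrCA subrr addr0 rnormBC.
  by have := CP x; have := lowP x; lra.
(* [C] itself need not be accretive, but its product with the adjoint of the nearby [P(u)] is, hence
   is onto. The adjoint of [P(u)] is injective, so [C] is onto. *)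
pose B : {linear H -> H} := polyop w (map_poly Num.conj P) \o C.
have bB : bounded_by B (M2 * (d / 4 + M1)).
  by move=> x; rewrite (le_trans (hM2 _)) // -mulrA ler_wpM2l // ltW.
have aB x : (d * 3 / 4 * (d / 2)) * rnorm x ^+ 2 <= rdot (B x) x.
  rewrite /= rdotC -(polyop_adj _ _ _ h).
  rewrite -[C x](subrK (polyop u P x)) rdotDr rdotxx.
  have h1 := rdot_norm_le (polyop u P x) (C x - polyop u P x).
  rewrite ler_norml in h1; case/andP: h1 => h1 _.
  have h2 := CP x; have h3 := lowP x; have h4 := rnorm_ge0 x.
  have h5 := rnorm_ge0 (polyop u P x).
  have h6 := ler_wpM2l h5 h2.
  have h7 : 0 <= rnorm (polyop u P x) - d / 4 * rnorm x - d / 2 * rnorm x by lra.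
  have h8 : 0 <= d / 2 * rnorm x by rewrite mulr_ge0 // ltW // divr_gt0.
  have h9 : 0 <= rnorm (polyop u P x) - d * 3 / 4 * rnorm x by lra.
  have := mulr_ge0 h5 h7; have := mulr_ge0 h8 h9; rewrite !expr2; lra.
have dd : 0 < d * 3 / 4 * (d / 2) by rewrite !mulr_gt0.
have ontoB := accretive_surj dd bB aB.
have injB : injective (polyop w (map_poly Num.conj P)).
  apply: bounded_below_inj; exists (d * 3 / 4); first by lra.
  by move=> x; rewrite (polyop_normal _ _ h).
apply/not_specP; split.
  exists (d / 2); first by rewrite divr_gt0.
  move=> x; have := lowC x; rewrite CE (up_rnorm_iter _ _ h).
  by rewrite eL L_diff rnormZ rnormN rnorm_i mul1r rnormBC.
move=> y.
have [x Bx] := ontoB (polyop w (map_poly Num.conj P) (iter m u (- 'i%C *: y))).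
exists x; move/injB: Bx; rewrite CE => /(can_inj (up_iterK m h)) e.
by rewrite eL L_diff -opprB scalerN -scaleNr e scalerA opprK mulrN -mulNr iNi scale1r.
Qed.

Lemma max_setE (A : set R[i]) t : A t%:C -> (forall z, A z -> z <= t%:C) -> max_set A = t.
Proof.
move=> At hA; apply: xget_unique => [//|s [As hs]].
by apply/eqP; rewrite eq_le -!lecR hA ?hs.
Qed.

Lemma min_setE (A : set R[i]) t : A t%:C -> (forall z, A z -> t%:C <= z) -> min_set A = t.
Proof.
move=> At hA; apply: xget_unique => [//|s [As hs]].
by apply/eqP; rewrite eq_le -!lecR hA ?hs.
Qed.

End LogSpectrum.

(** * The extreme angles as extreme arguments of the spectrum *)

Section Theta.
Variables (R : realType) (H : hilbertType R).
Hypothesis H0 : exists x : H, x != 0.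
Implicit Types (u w v : {linear H -> H}).

Lemma spec_inverse u w t : unitary_pair u w -> spec u (expi t) -> spec w (expi (- t)).
Proof.
move=> h /(spec_unitaryP _ h) su; apply/(spec_unitaryP _ (unitary_pairC h)) => e e0.
have [x hx] := su e e0; exists x.
have -> : w x - expi (- t) *: x = - expi (- t) *: w (u x - expi t *: x).
  by rewrite (linB w) (upK h) (linZ w) scaleNr scalerBr scalerA expiNM scale1r opprB.
by rewrite rnormZ rnormN rnorm_expi mul1r (up_rnorm _ (unitary_pairC h)).
Qed.

Definition spec_hull (u : H -> H) (a b : R) :=
  [/\ - pi < a <= b, b < pi, spec u (expi b), spec u (expi a) &
      forall t, - pi < t <= pi -> spec u (expi t) -> a <= t <= b].

Lemma thetaP u w : unitary_pair u w -> ~ spec u (-1) ->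
  spec_hull u (theta_minus u) (theta_plus u).
Proof.
move=> h u1; have h' := unitary_pairC h.
have w1 : ~ spec w (-1).
  by rewrite -expipi => /(spec_inverse h'); rewrite expiN expipi rmorphN rmorph1.
have [b [/andP[b1 b2] sb hb]] := spec_arg_max h H0 u1.
have [a' [/andP[a1 a2] sa' ha]] := spec_arg_max h' H0 w1.
(* The least argument of [u] is minus the greatest argument of its inverse. *)
pose a := - a'.
have sa : spec u (expi a) := spec_inverse h' sa'.
have hab t : - pi < t <= pi -> spec u (expi t) -> a <= t <= b.
  move=> ht st; rewrite hb // andbT lerNl; apply: ha; last exact: spec_inverse st.
  case/andP: ht => t1 t2; rewrite (lerNl t) (ltW t1) andbT ltrN2 lt_neqAle t2 andbT.
  by apply/eqP => e; apply: u1; move: st; rewrite e expipi.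
(* [cfc] is a choice by [get]: existence yields its specification, and the two spectral lemmas hold
   for every operator that meets it. *)
have cS : is_cfc u (@principal_log R) (log_op u) := getPex (log_exists h u1).
have seg := log_spec_segment h cS hab.
have tp : theta_plus u = b.
  apply: max_setE => [|z /seg[t /andP[_ tb] ->]]; last by rewrite lecR.
  by apply: (log_spec_arg h cS) => //; rewrite b1 ltW.
have tm : theta_minus u = a.
  apply: min_setE => [|z /seg[t /andP[ta _] ->]]; last by rewrite lecR.
  by apply: (log_spec_arg h cS) => //; rewrite ltrN2 a2 lerNl ltW.
rewrite tp tm; split=> //; rewrite ltrN2 a2 /=.
have bpi : - pi < b <= pi by rewrite b1 ltW.
by have /andP[] := hab b bpi sb.
Qed.

Lemma unitary_opP (f : H -> H) : unitary_op f ->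
  exists u w : {linear H -> H}, u = f :> (H -> H) /\ unitary_pair u w.
Proof.
move=> [[linf _] [g [[[ling _] fg] fK gK]]].
have [u eu] := linear_pack linf; have [w ew] := linear_pack ling.
by exists u, w; split=> //; split; rewrite ?eu ?ew.
Qed.

End Theta.

(** * Products of two unitaries *)

Section Composition.
Variables (R : realType) (H : hilbertType R).
Implicit Types (u v : {linear H -> H}).

(** Angles of the complementary arc beyond [pi] return to the principal range by subtracting
    [2 pi]. *)
Lemma spec_hull_gap u a b s : spec_hull u a b -> b < s < a + pi *+ 2 -> ~ spec u (expi s).
Proof.
move=> [/andP[a1 ab] b1 _ _ hab] /andP[s1 s2] ss.
have [spi|spi] := leP s pi.
  have hs : - pi < s <= pi by rewrite spi andbT; lra.
  by have /andP[_] := hab s hs ss; lra.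
rewrite (mulr2n pi) in s2.
have hs : - pi < s - pi *+ 2 <= pi by rewrite mulr2n; apply/andP; split; lra.
have := hab _ hs; rewrite expiB2pi => /(_ ss); rewrite mulr2n => /andP[].
by lra.
Qed.

Variables u u' v v' : {linear H -> H}.
Hypotheses (hu : unitary_pair u u') (hv : unitary_pair v v').
Variables a b c d : R.
Hypotheses (ub : spec_hull u a b) (vb : spec_hull v c d).

Let bounds : [/\ - pi < a, a <= b, b < pi & [/\ - pi < c, c <= d & d < pi]].
Proof. by case: ub => /andP[? ?] ? _ _ _; case: vb => /andP[? ?] ? _ _ _. Qed.

Let gap_u s : b < s -> s < a + (pi + pi) -> ~ spec u (expi s).
Proof. by move=> s1 s2; apply: (spec_hull_gap ub); rewrite mulr2n s1. Qed.

Let gap_v s : d < s -> s < c + (pi + pi) -> ~ spec v (expi s).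
Proof. by move=> s1 s2; apply: (spec_hull_gap vb); rewrite mulr2n s1. Qed.

Lemma comp_spec_gap t : b + d < t < a + c + pi *+ 2 -> ~ spec (u \o v) (expi t).
Proof.
rewrite mulr2n => /andP[t1 t2]; have [a1 ab b1 [c1 cd d1]] := bounds.
(* Centre and half-width of the whole gap from [b] to [a + 2 pi]. Next, [k'] is the least value for
   which the arc of [v] of centre [t - g + pi] and half-width [pi - k'] fits between [d] and
   [c + 2 pi]; the range of [t] is exactly [k' < k]. *)
pose g := (b + a) / 2 + pi; pose k := (a - b) / 2 + pi.
pose k' := Num.max (d + g - t) (t - g - c).
have k'1 : d + g - t <= k' by rewrite le_max lexx.
have k'2 : t - g - c <= k' by rewrite le_max lexx orbT.
have k'3 : k' < k by rewrite gt_max /k /g; apply/andP; split; lra.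
apply: (comp_not_spec hu hv (g := g) (k := k) (k' := k')) => //.
- by lra.
- by rewrite /k; lra.
- by move=> s; rewrite ltr_norml /k /g => /andP[s1 s2]; apply: gap_u; lra.
- by move=> s; rewrite ltr_norml => /andP[s1 s2]; apply: gap_v; lra.
Qed.

(* The arcs containing [spec u] and [e^(it) (spec v)^-1] abut at the angle [b], and
   [q] is the midpoint of the gap between their other ends. *)
Lemma comp_eigenvector_max x : b + d < a + c + pi *+ 2 ->
  u (v x) = expi (b + d) *: x -> u x = expi b *: x /\ v x = expi d *: x.
Proof.
rewrite mulr2n => t2 e; have [a1 ab b1 [c1 cd d1]] := bounds.
pose q := (b + d - c + (a + (pi + pi))) / 2.
have [q1 q2 q3 q4] : [/\ b < q, q < a + (pi + pi), b + d - c < q & q < b + (pi + pi)].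
  by rewrite /q; split; lra.
move: q q1 q2 q3 q4 => q q1 q2 q3 q4.
have [g [k [gk gk']]] : exists g k, g - k = b /\ g + k = q.
  by exists ((b + q) / 2), ((q - b) / 2); split; field.
have k0 : 0 <= k by lra.
have k1 : 0 <= pi - k by lra.
have kpi : 0 <= k <= pi by apply/andP; split; lra.
have k'pi : 0 <= pi - k <= pi by apply/andP; split; lra.
have au : avoids_arc u g k.
  by move=> s; rewrite ltr_norml => /andP[s1 s2]; apply: gap_u; lra.
have av : avoids_arc v (b + d - g + pi) (pi - k).
  by move=> s; rewrite ltr_norml => /andP[s1 s2]; apply: gap_v; lra.
have [e1 e2] := comp_eigenvector hu hv kpi au av e.
have vx : v x = expi d *: x.
  (* The arc avoided by [v] runs from [d] to [b + d + 2 pi - q]. The latter is inside the gap of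
     [spec v], which leaves [d] as the eigenvalue angle. *)
  have -> : d = b + d - g + pi - (pi - k) by lra.
  apply: (extremal_eigenvector hv k'pi av _ _ e2); first by rewrite ger0_norm.
  by apply: gap_v; lra.
split=> //.
have uvx : u (v x) = expi b *: v x.
  rewrite -gk; apply: (extremal_eigenvector hu kpi au _ _ e1); first by rewrite ger0_norm.
  by rewrite gk'; apply: gap_u.
move: uvx; rewrite vx (linZ u) scalerA mulrC -scalerA.
by apply: scalerI; rewrite -rnorm_eq0 rnorm_expi oner_eq0.
Qed.

(** Mirror image of the maximal case: the two arcs abut at [a], taken as [a + 2 pi], and [q] is the
    midpoint between [b] and [a + c + 2 pi - d]. The eigenvalues sit at the upper ends of the
    avoided arcs, hence the negative [j]. *)
Lemma comp_eigenvector_min x : b + d < a + c + pi *+ 2 ->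
  u (v x) = expi (a + c) *: x -> u x = expi a *: x /\ v x = expi c *: x.
Proof.
rewrite mulr2n => t2 e; have [a1 ab b1 [c1 cd d1]] := bounds.
pose q := (b + (a + c + (pi + pi) - d)) / 2.
have [q1 q2 q3 q4] : [/\ b < q, q < a + (pi + pi), q < a + c + (pi + pi) - d & a < q].
  by rewrite /q; split; lra.
move: q q1 q2 q3 q4 => q q1 q2 q3 q4.
have [g [k [gk gk']]] : exists g k, g - k = q /\ g + k = a + (pi + pi).
  by exists ((a + (pi + pi) + q) / 2), ((a + (pi + pi) - q) / 2); split; field.
have k0 : 0 <= k by lra.
have k1 : 0 <= pi - k by lra.
have kpi : 0 <= k <= pi by apply/andP; split; lra.
have k'pi : 0 <= pi - k <= pi by apply/andP; split; lra.
have au : avoids_arc u g k.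
  by move=> s; rewrite ltr_norml => /andP[s1 s2]; apply: gap_u; lra.
have av : avoids_arc v (a + c - g + pi) (pi - k).
  move=> s; rewrite ltr_norml => /andP[s1 s2].
  by rewrite -expiD2pi mulr2n; apply: gap_v; lra.
have [e1 e2] := comp_eigenvector hu hv kpi au av e.
have vx : v x = expi c *: x.
  have -> : c = a + c - g + pi - - (pi - k) by lra.
  apply: (extremal_eigenvector hv k'pi av _ _ e2); first by rewrite normrN ger0_norm.
  by rewrite -expiD2pi mulr2n; apply: gap_v; lra.
split=> //.
have uvx : u (v x) = expi a *: v x.
  rewrite -expiD2pi mulr2n -gk' -[k]opprK.
  apply: (extremal_eigenvector hu kpi au _ _ e1); first by rewrite normrN ger0_norm.
  by rewrite gk; apply: gap_u.
move: uvx; rewrite vx (linZ u) scalerA mulrC -scalerA.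
by apply: scalerI; rewrite -rnorm_eq0 rnorm_expi oner_eq0.
Qed.

End Composition.

Theorem theorem3p3 (R : realType) (H : hilbertType R)
  (H_nonzero : exists x : H, x != 0) (H_separable : separable_space H)
  (u v : H -> H) (hu : unitary_op u) (hv : unitary_op v)
  (hu1 : ~ spec u (-1)) (hv1 : ~ spec v (-1))
  (hplus : theta_plus u + theta_plus v < pi)
  (hminus : - pi < theta_minus u + theta_minus v) :
  [/\ ~ spec (u \o v) (-1),
      theta_plus (u \o v) <= theta_plus u + theta_plus v,
      theta_minus u + theta_minus v <= theta_minus (u \o v),
      theta_plus (u \o v) = theta_plus u + theta_plus v ->
      theta_plus u + theta_plus v < pi ->
      H_plus u `&` H_plus v = H_plus (u \o v) &
      theta_minus (u \o v) = theta_minus u + theta_minus v ->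
      - pi < theta_minus u + theta_minus v ->
      H_minus u `&` H_minus v = H_minus (u \o v)].
Proof.
have [U [U' [eU hU]]] := unitary_opP hu; have [V [V' [eV hV]]] := unitary_opP hv.
subst u v.
have hUV := up_comp hU hV.
have hullU := thetaP H_nonzero hU hu1; have hullV := thetaP H_nonzero hV hv1.
have sumgap (a b c d : R) : b + d < pi -> - pi < a + c -> b + d < a + c + pi *+ 2.
  by move=> h1 h2; rewrite mulr2n; clear -h1 h2; lra.
have gap := comp_spec_gap hU hV hullU hullV.
have uv1 : ~ spec (U \o V) (-1).
  (* The angle [pi] is in the gap: the two hypotheses say [b + d < pi] and [pi < a + c + 2 pi]. *)
  rewrite -expipi; apply: gap; rewrite hplus /=.
  by rewrite -ltrBlDr mulr2n opprD addrA subrr sub0r.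
have hullUV := thetaP H_nonzero hUV uv1.
move: hplus hminus hullU hullV gap hullUV; rewrite /H_plus /H_minus.
move: (theta_plus U) (theta_minus U) (theta_plus V) (theta_minus V).
move: (theta_plus (U \o V)) (theta_minus (U \o V)).
move=> q p b a d c hplus hminus hullU hullV gap [/andP[p1 pq] q1 sq sp _].
have {}sumgap := sumgap _ _ _ _ hplus hminus.
split=> //.
(* The attained maximum [q] is below [pi], so exceeding [b + d] would place it in the gap. *)
- rewrite leNgt; apply/negP => lt; apply: gap sq; rewrite lt mulr2n.
  by clear -hminus q1; lra.
(* The attained minimum [p] is moved to [p + 2 pi], which is above [pi], hence above [b + d]. *)
- rewrite leNgt; apply/negP => lt; move: sp; rewrite -expiD2pi; apply: gap.
  by rewrite ltrD2r lt andbT mulr2n; clear -hplus p1; lra.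
- move=> e _; rewrite e; apply/seteqP; split=> x /=.
    by move=> [ux vx]; rewrite vx (linZ U) ux scalerA -expiD addrC.
  exact: (comp_eigenvector_max hU hV hullU hullV sumgap).
- move=> e _; rewrite e; apply/seteqP; split=> x /=.
    by move=> [ux vx]; rewrite vx (linZ U) ux scalerA -expiD addrC.
  exact: (comp_eigenvector_min hU hV hullU hullV sumgap).
Qed.
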